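(* Let $K$ be a field, $R=K[x_1,\dots,x_n]$, $T=K[y_1,\dots,y_m]$ and $S=R\otimes_K T=K[x_1,\dots,x_n,y_1,\dots,y_m]$. Let $I\subset R$ and $J\subset T$ be proper nonzero monomial ideals, whose extensions to $S$ are again denoted by $I$ and $J$. Suppose that $\mathrm{v}(I^k)<\operatorname{reg}(I^k)$ and $\mathrm{v}(J^k)<\operatorname{reg}(J^k)$ for all $k\gg0$. Then $\mathrm{v}((I+J)^k)<\operatorname{reg}((I+J)^k)$ for all $k\gg0$.
   Context: Polynomial rings are standard graded. For an ideal $L$ of a polynomial ring $S$, $\operatorname{Ass}(L)$ denotes the set of associated primes of $S/L$. For a proper graded ideal $L$ and $\mathfrak{p}\in\operatorname{Ass}(L)$, $\mathrm{v}_{\mathfrak{p}}(L)$ is the least degree of a homogeneous polynomial $f$ such that $(L:f)=\mathfrak{p}$, and $\mathrm{v}(L)=\min_{\mathfrak{p}\in\operatorname{Ass}(L)}\mathrm{v}_{\mathfrak{p}}(L)$. $\operatorname{reg}(L)$ is the Castelnuovo–Mumford regularity of $L$ as a graded module. ''For all $k\gg0$'' means for all sufficiently large integers $k$. *)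

(* Defs.v *)
From mathcomp Require Import all_boot all_order all_algebra.
From mathcomp Require Import boolp classical_sets mpoly.

Set Implicit Arguments.
Unset Strict Implicit.
Unset Printing Implicit Defensive.

Import GRing.Theory.
Local Open Scope classical_set_scope.
Local Open Scope ring_scope.

(* Least element of a set of naturals; the empty set is sent to 0. *)
Definition least (P : set nat) : nat :=
  xget 0%N [set d | P d /\ forall e, P e -> (d <= e)%N].

Section Ideals.
Variables (K : fieldType) (n : nat).
Local Notation S := {mpoly K[n]}.
Implicit Types (I J L p : set S).

Definition ideal_gen (G : set S) : set S :=
  [set q | exists r (c g : 'I_r -> S),
     (forall i, G (g i)) /\ q = \sum_(i < r) c i * g i].

Definition is_ideal I : Prop :=
  [/\ I 0, forall f g, I f -> I g -> I (f + g) & forall h f, I f -> I (h * f)].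

Definition monomial_ideal I : Prop :=
  exists M : set 'X_{1..n}, I = ideal_gen [set 'X_[m] | m in M].

Definition idealD I J : set S := [set f + g | f in I & g in J].

Definition idealM I J : set S := ideal_gen [set f * g | f in I & g in J].

Fixpoint idealX I (k : nat) : set S :=
  if k is k'.+1 then idealM I (idealX I k') else setT.

Definition prime_ideal p : Prop :=
  [/\ is_ideal p, ~ p 1 & forall f g, p (f * g) -> p f \/ p g].

Definition colon L (f : S) : set S := [set g | L (g * f)].

Definition Ass L : set (set S) :=
  [set p | prime_ideal p /\ exists f, colon L f = p].

(* For p in Ass L and L graded, the set of degrees below is nonempty, so the
   default value of [least] is not used.  The zero polynomial, homogeneous of
   every degree, never contributes since colon L 0 = setT. *)
Definition v_at p L : nat :=
  least [set d | exists f : S, f \is d.-homog /\ colon L f = p].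

Definition vnum L : nat := least [set v_at p L | p in Ass L].

(* Minimal graded free resolution of L regarded as a graded S-module:
     ... -> F_1 -> F_0 -> L -> 0,  F_i = \bigoplus_(a < rk i) S(- dg i a).
   Elements of F_i are row vectors and the maps act by right multiplication,
   so row a of [dif i] is the image in F_i of the a-th basis vector of F_{i+1}.
   Natural number shifts lose nothing: by minimality the generators of F_0
   map to nonzero elements of L, and shifts increase along the resolution.
   Ranks may be zero, so that finite resolutions are included. *)
Record min_graded_free_res L := MinGradedFreeRes {
  rk : nat -> nat;
  dg : forall i, 'I_(rk i) -> nat;
  aug : 'cV[S]_(rk 0);
  dif : forall i, 'M[S]_(rk i.+1, rk i);
  aug_homog : forall a, aug a 0 \is (dg a).-homog;
  dif_homog : forall i a b, dif i a b != 0 ->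
    exists2 e, dg a = (dg b + e)%N & dif i a b \is e.-homog;
  aug_image : forall f, L f <-> exists v : 'rV[S]_(rk 0), (v *m aug) 0 0 = f;
  exact_aug : forall v : 'rV[S]_(rk 0),
    v *m aug = 0 <-> exists w : 'rV[S]_(rk 1), v = w *m dif 0;
  exact_dif : forall i (v : 'rV[S]_(rk i.+1)),
    v *m dif i = 0 <-> exists w : 'rV[S]_(rk i.+2), v = w *m dif i.+1;
  (* the differentials have entries in the ideal (x_1, ..., x_n) *)
  dif_minimal : forall i a b, (dif i a b)@_0%MM = 0
}.

(* r = max { j - i | beta_{i,j}(L) != 0 } *)
Definition is_reg L (r : nat) : Prop :=
  exists F : min_graded_free_res L,
    (forall i (a : 'I_(rk F i)), (dg a <= r + i)%N) /\
    (exists i (a : 'I_(rk F i)), dg a = (r + i)%N).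

(* The maximum exists, is nonnegative and is independent of the resolution
   for every nonzero graded ideal L; the default 0 is not used there. *)
Definition reg L : nat := xget 0%N [set r | is_reg L r].

End Ideals.

Section Extension.
Variables (K : fieldType) (n m : nat).

(* K[x_1..x_n] (x) K[y_1..y_m] is K[n + m], with x_i the variable [lshift m i]
   and y_j the variable [rshift n j]. *)
Definition inclx : {mpoly K[n]} -> {mpoly K[n + m]} :=
  comp_mpoly [tuple 'X_(lshift m i) | i < n].

Definition incly : {mpoly K[m]} -> {mpoly K[n + m]} :=
  comp_mpoly [tuple 'X_(rshift n j) | j < m].

Definition extx (I : set {mpoly K[n]}) : set {mpoly K[n + m]} :=
  ideal_gen [set inclx f | f in I].

Definition exty (J : set {mpoly K[m]}) : set {mpoly K[n + m]} :=
  ideal_gen [set incly g | g in J].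

End Extension.

Arguments extx {K n} m I.
Arguments exty {K} n {m} J.

(* Main.v *)
(* Let L = (I + J) ^ k and k + 1 = a + b with a and b large.  Since
   v(I ^ a) <= reg(I ^ a) - 1 and v(J ^ b) <= reg(J ^ b) - 1, it suffices that
     v(L) <= v(I ^ a) + v(J ^ b)   and   reg(L) >= reg(I ^ a) + reg(J ^ b) - 1.

   For the first inequality take monomials f and g of minimal degree with
   I ^ a : f = p and J ^ b : g = q.  As f I lies in I ^ a and I ^ a : I = I ^ (a - 1)
   for large a (Ratliff), f lies in I ^ (a - 1), and g in J ^ (b - 1); this gives
   L : fg = p + q.

   For the second one, Betti numbers are read off Koszul homology.  Multigraded
   cone operators show that the Koszul homology of I ^ a maps to zero in that of
   I ^ (a - 1), because dividing a monomial of I ^ a by a variable leaves it in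
   I ^ (a - 1).  So cycles z over I ^ a and w over J ^ b bound z' over I ^ (a - 1) and
   w' over J ^ (b - 1), and z * w' +- z' * w is a cycle over L, which is not a
   boundary if z and w are not. *)

Require Import Defs.
From HB Require Import structures.
From mathcomp Require Import all_boot all_order all_algebra.
From mathcomp Require Import boolp classical_sets ssrcomplements mpoly.
From mathcomp Require Import zify ring.

Set Implicit Arguments.
Unset Strict Implicit.
Unset Printing Implicit Defensive.

Import GRing.Theory.
Local Open Scope classical_set_scope.
Local Open Scope ring_scope.

(** The value [reg] is tied to some minimal resolution, a different one for each of the three
    ideals, and nothing in the definitions relates them. Koszul homology with coefficients in the
    ideal is the meeting ground: a basis vector of degree [d] in step [i] of any minimal resolution
    produces a nonzero class of Koszul degree [i] and internal degree [d], and such a class forces a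
    basis vector of degree [d] in step [i] of every minimal resolution. The shift by one in the
    estimate for [reg(L)] comes from [z'], whose Koszul degree is one more than that of [z]:
    homological degrees add up to [i + j + 1], while internal degrees just add. All ideals are
    handled as up-closed sets of exponents. *)

(** * Linear maps on polynomials prescribed on monomials *)

Section LinearExtension.
Variables (K : fieldType) (n : nat).
Local Notation S := {mpoly K[n]}.

Definition lext (V : lmodType K) (phi : 'X_{1..n} -> V) (p : S) : V :=
  \sum_(m <- msupp p) p@_m *: phi m.

Lemma lextwE (V : lmodType K) (phi : 'X_{1..n} -> V) k (p : S) :
  (msize p <= k)%N -> lext phi p = \sum_(m : 'X_{1..n < k}) p@_m *: phi m.
Proof.
move=> le_pk; rewrite /lext (big_mksub 'X_{1..n < k}) /=; first last.
- by move=> m /msize_mdeg_lt /leq_trans; apply.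
- exact: msupp_uniq.
by rewrite big_rmcond //= => m /memN_msupp_eq0 ->; rewrite scale0r.
Qed.

Lemma lext_is_linear (V : lmodType K) (phi : 'X_{1..n} -> V) :
  linear (lext phi).
Proof.
move=> c p q; set k := maxn (msize (c *: p + q)) (maxn (msize p) (msize q)).
rewrite !(@lextwE _ _ k) ?leq_max ?leqnn ?orbT //.
rewrite scaler_sumr -big_split /=; apply: eq_bigr => m _.
by rewrite mcoeffD mcoeffZ scalerDl scalerA.
Qed.

HB.instance Definition _ (V : lmodType K) (phi : 'X_{1..n} -> V) :=
  GRing.isLinear.Build K S V _ (lext phi) (lext_is_linear phi).

Lemma lextX (V : lmodType K) (phi : 'X_{1..n} -> V) m :
  lext phi 'X_[m] = phi m.
Proof. by rewrite /lext msuppX big_seq1 mcoeffX eqxx scale1r. Qed.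

(** Linearity is a hypothesis on bare functions, so that the lemma applies directly to composites
    such as a multiplication followed by [divm]. *)
Lemma eq_linear_mpoly (V : lmodType K) (f g : S -> V) :
  linear f -> linear g -> (forall m, f 'X_[m] = g 'X_[m]) -> f =1 g.
Proof.
move=> lf lg fg p; elim/mpolyind: p => [|c m p _ _ IH].
  have z h : linear h -> h 0 = 0 :> V.
    by move=> /(_ (-1) 0 0); rewrite scaler0 addr0 scaleN1r addNr.
  by rewrite !z.
by rewrite lf lg fg IH.
Qed.

Definition keep (P : pred 'X_{1..n}) : S -> S :=
  lext (fun m => if P m then 'X_[m] else 0).

HB.instance Definition _ P := GRing.Linear.on (keep P).

Lemma mcoeff_keep P p m : (keep P p)@_m = if P m then p@_m else 0.
Proof.
apply: (@eq_linear_mpoly K^o (fun p => (keep P p)@_m)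
  (fun p => if P m then p@_m else 0)) => [c f g|c f g|m'].
- by rewrite linearP mcoeffD mcoeffZ.
- by case: ifP => _; rewrite ?scaler0 ?addr0 // mcoeffD mcoeffZ.
rewrite /keep lextX mcoeffX; case: (m' =P m) => [->|/eqP mm'].
  by case: ifP; rewrite ?mcoeffX ?eqxx ?mcoeff0.
by case: ifP; rewrite ?mcoeffX ?(negbTE mm') ?mcoeff0; case: ifP.
Qed.

Lemma keepX P m : keep P 'X_[m] = if P m then 'X_[m] else 0.
Proof. by rewrite /keep lextX. Qed.

Lemma keep_split P p : p = keep P p + keep (predC P) p.
Proof.
apply/mpolyP => m; rewrite mcoeffD !mcoeff_keep /=.
by case: (P m); rewrite /= ?addr0 ?add0r.
Qed.

Lemma mem_msupp_keep P p m : (m \in msupp (keep P p)) = P m && (m \in msupp p).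
Proof. by rewrite !mcoeff_msupp mcoeff_keep; case: (P m); rewrite ?eqxx. Qed.

Definition divm (u : 'X_{1..n}) : S -> S :=
  lext (fun m => if (u <= m)%MM then 'X_[m - u] else 0).

HB.instance Definition _ u := GRing.Linear.on (divm u).

Lemma divmX u m : divm u 'X_[m] = if (u <= m)%MM then 'X_[m - u] else 0.
Proof. by rewrite /divm lextX. Qed.

Lemma divmMl u p : divm u ('X_[u] * p) = p.
Proof.
apply: (@eq_linear_mpoly _ (fun p => divm u ('X_[u] * p)) id) => [c f g|c f g|m] //.
  by rewrite mulrDr -scalerAr linearP.
by rewrite -mpolyXD divmX lem_addr addmC addmK.
Qed.

Lemma divmMr (u w : 'X_{1..n}) p : (forall i, u i = 0%N \/ w i = 0%N) ->
  divm u ('X_[w] * p) = 'X_[w] * divm u p.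
Proof.
move=> uw; apply: (@eq_linear_mpoly _ (fun p => divm u ('X_[w] * p))
   (fun p => 'X_[w] * divm u p)) => [c f g|c f g|m].
- by rewrite mulrDr -scalerAr linearP.
- by rewrite linearP mulrDr -scalerAr.
rewrite -mpolyXD !divmX.
have -> : (u <= w + m)%MM = (u <= m)%MM.
  apply/mnm_lepP/mnm_lepP => le i; have := le i; rewrite mnmDE.
    by case: (uw i) => ->.
  by move=> h; apply: leq_trans h (leq_addl _ _).
case: ifP => [/mnm_lepP le|_]; last by rewrite mulr0.
by rewrite -mpolyXD; congr 'X_[_]; apply/mnmP => i; rewrite !(mnmBE, mnmDE) addnBA.
Qed.

Lemma keep_ndiv u p : p - 'X_[u] * divm u p = keep (fun m => ~~ (u <= m)%MM) p.
Proof.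
apply: (@eq_linear_mpoly _ (fun p => p - 'X_[u] * divm u p)) => [c f g||m].
- rewrite linearP mulrDr -scalerAr scalerBr opprD !addrA; congr (_ - _).
  by rewrite -!addrA; congr (_ + _); rewrite addrC.
- exact: linearP.
rewrite keepX divmX; case: ifP => h /=; last by rewrite mulr0 subr0.
by rewrite -mpolyXD addmC submK // subrr.
Qed.

Lemma mem_msupp_divm u p (m : 'X_{1..n}) : m \in msupp (divm u p) -> (u + m)%MM \in msupp p.
Proof.
move=> h; apply/contraT => /memN_msupp_eq0 pz; move: h.
have : (p - keep (fun m => ~~ (u <= m)%MM) p)@_(u + m) = 0.
  by rewrite mcoeffB mcoeff_keep lem_addr pz subr0.
rewrite -keep_ndiv subKr -commr_mpolyX mcoeffMX => h.
by rewrite mcoeff_msupp h eqxx.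
Qed.

End LinearExtension.

(** * Dickson's lemma and powers of monomial sets *)

(** The coordinate functions on an arbitrary type allow three uses: on exponents, on pairs of
    exponents, and on polynomials through their leading monomials. *)
Lemma dickson (T : eqType) (I : finType) (x : I -> T -> nat) (P : set T) :
  exists l : seq T, (forall g, g \in l -> P g) /\
    (forall f, P f -> exists2 g, g \in l & forall i, (x i g <= x i f)%N).
Proof.
suff {P} H (s : seq I) : forall P : set T, exists l : seq T,
    (forall g, g \in l -> P g) /\
    (forall f, P f -> exists2 g, g \in l & forall i, i \in s -> (x i g <= x i f)%N).
  have [l [lP lle]] := H (enum I) P; exists l; split=> // f /lle [g gl gf].
  by exists g => // i; apply: gf; rewrite mem_enum.
elim: s => [|i s IH] P.
  case: (pselect (exists f, P f)) => [[f Pf]|nP]; last first.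
    by exists [::]; split=> // f Pf; case: nP; exists f.
  exists [:: f]; split=> [g|g _]; first by rewrite inE => /eqP ->.
  by exists f; rewrite ?mem_head.
have [l0 [l0P l0le]] := IH P.
pose b := (\max_(g <- l0) x i g)%N.
(* The elements whose [i]-th coordinate is at least [b] are above [l0]; the
   others are split according to that coordinate. *)
have slice c : exists l : seq T, (forall g, g \in l -> P g) /\
    (forall f, P f -> (x i f < c)%N ->
      exists2 g, g \in l & forall j, j \in i :: s -> (x j g <= x j f)%N).
  elim: c => [|c [l [lP lle]]]; first by exists [::].
  have [l' [l'P l'le]] := IH [set f | P f /\ x i f = c].
  exists (l ++ l'); split=> [g|f Pf].
    by rewrite mem_cat => /orP[/lP|/l'P[]].
  rewrite ltnS leq_eqVlt => /orP[/eqP fc|/(lle f Pf)[g gl gf]]; last first.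
    by exists g; rewrite // mem_cat gl.
  have [g gl gf] := l'le f (conj Pf fc); exists g; first by rewrite mem_cat gl orbT.
  by move=> j; rewrite inE => /orP[/eqP ->|/gf//]; have [_ ->] := l'P g gl; rewrite fc.
have [l [lP lle]] := slice b; exists (l0 ++ l); split=> [g|f Pf].
  by rewrite mem_cat => /orP[/l0P|/lP].
have [lt|ge] := ltnP (x i f) b.
  by have [g gl gf] := lle f Pf lt; exists g; rewrite // mem_cat gl orbT.
have [g gl gf] := l0le f Pf; exists g; first by rewrite mem_cat gl.
move=> j; rewrite inE => /orP[/eqP ->|/gf//].
by apply: leq_trans ge; rewrite /b (big_rem g) //= leq_maxl.
Qed.

Section MonomialSets.
Variable n : nat.
Implicit Types (A B : set 'X_{1..n}) (m u : 'X_{1..n}).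

Definition upclosed A := forall m u, A m -> A (m + u)%MM.

Definition msum A B : set 'X_{1..n} :=
  [set m | exists a b, [/\ A a, B b & m = (a + b)%MM]].

(** The base [setT] mirrors [idealX] and makes every power up-closed, the last summand being
    arbitrary. *)
Fixpoint mpow A k : set 'X_{1..n} := if k is k'.+1 then msum A (mpow A k') else setT.

Lemma upclosed_msum A B : upclosed B -> upclosed (msum A B).
Proof.
move=> upB m u [a [b [Aa Bb ->]]]; exists a, (b + u)%MM; split=> //.
  exact: upB.
by rewrite addmA.
Qed.

Lemma upclosed_mpow A k : upclosed (mpow A k).
Proof. by elim: k => //= k IH; apply: upclosed_msum. Qed.

Lemma mpowS A k m : mpow A k.+1 m -> mpow A k m.
Proof.
elim: k m => //= k IH m [a [b [Aa Bb ->]]].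
by exists a, b; split=> //; apply: IH.
Qed.

Lemma mpow_le A j k m : (j <= k)%N -> mpow A k m -> mpow A j m.
Proof. by move=> /subnK <-; elim: (k - j)%N => // i IH; rewrite addSn => /mpowS. Qed.

Lemma mpowD A j k a b : mpow A j a -> mpow A k b -> mpow A (j + k) (a + b)%MM.
Proof.
elim: j a => [|j IH] a /=.
  by move=> _ Bb; rewrite add0n addmC; apply: upclosed_mpow.
move=> [a1 [a2 [Aa1 Aa2 ->]]] Bb; rewrite -addmA.
by exists a1, (a2 + b)%MM; split=> //; apply: IH.
Qed.

Lemma mpow0n A k : ~ A 0%MM -> (0 < k)%N -> ~ mpow A k 0%MM.
Proof.
case: k => // k A0 _ [a [b [Aa _ /esym/eqP]]]; rewrite mnmD_eq0 => /andP[/eqP a0 _].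
by rewrite a0 in Aa.
Qed.

(* Dividing by a variable destroys at most one of the [k + 1] factors. *)
Lemma mpow_divU A k m i : mpow A k.+1 (U_(i) + m)%MM -> mpow A k m.
Proof.
elim: k m => // k IH m [a [b [Aa Bb mab]]].
have [bi|bi] := boolP (0 < b i)%N.
  have Ub : (U_(i) <= b)%MM by rewrite lep1mP -lt0n.
  exists a, (b - U_(i))%MM; split=> //.
    by apply: IH; rewrite addmC submK.
  by apply: (@addmI _ U_(i)%MM); rewrite mab addmA [(U_(i) + a)%MM]addmC -addmA
    [(U_(i) + (_ - _))%MM]addmC submK.
have ai : (U_(i) <= a)%MM.
  rewrite lep1mP; move: bi; rewrite -eqn0Ngt => /eqP bi.
  by move/mnmP: mab => /(_ i); rewrite !mnmDE mnm1E eqxx bi addn0 => <-.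
suff -> : m = (b + (a - U_(i)))%MM by apply: upclosed_mpow.
apply: (@addmI _ U_(i)%MM); rewrite mab addmC -{1}(submK ai).
by rewrite [(a - _ + _)%MM]addmC addmA [(b + _)%MM]addmC addmA.
Qed.

(** With one new variable for each generator, [e] is a monomial in the new variables and [gsum g e]
    its image: the presentation of the Rees algebra, on exponents. *)
Definition gsum r (g : 'I_r -> 'X_{1..n}) (e : 'X_{1..r}) : 'X_{1..n} :=
  (\sum_i g i *+ e i)%MM.

Lemma gsumD r (g : 'I_r -> 'X_{1..n}) e f :
  gsum g (e + f)%MM = (gsum g e + gsum g f)%MM.
Proof.
rewrite /gsum -big_split /=; apply: eq_bigr => i _.
by apply/mnmP => j; rewrite !(mulmnE, mnmDE) mulnDr.
Qed.

Lemma gsum1 r (g : 'I_r -> 'X_{1..n}) i : gsum g U_(i)%MM = g i.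
Proof.
rewrite /gsum (bigD1 i) //= mnm1E eqxx mulm1n big1 ?addm0 // => j ji.
by rewrite mnm1E eq_sym (negbTE ji).
Qed.

Lemma mdeg_gt0P r (e : 'X_{1..r}) k : mdeg e = k.+1 ->
  exists i e', e = (U_(i) + e')%MM /\ mdeg e' = k.
Proof.
move=> de; have [i ei] : exists i, (0 < e i)%N.
  apply/existsP; apply/contraT; rewrite negb_exists => /forallP e0.
  suff e00 : e = 0%MM by rewrite e00 mdeg0 in de.
  by apply/mnmP => i; rewrite mnm0E; have := e0 i; rewrite -eqn0Ngt => /eqP.
have Ue : (U_(i) <= e)%MM by rewrite lep1mP -lt0n.
exists i, (e - U_(i))%MM; split; first by rewrite addmC submK.
by have := congr1 (@mdeg r) (submK Ue); rewrite mdegD mdeg1 de addn1 => -[].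
Qed.

Lemma mpow_gsum A r (g : 'I_r -> 'X_{1..n}) e :
  (forall i, A (g i)) -> mpow A (mdeg e) (gsum g e).
Proof.
move=> Ag; move de: (mdeg e) => k; elim: k e de => // k IH e.
move=> /mdeg_gt0P[i [e' [-> de']]]; rewrite gsumD gsum1.
by exists (g i), (gsum g e'); split=> //; apply: IH.
Qed.

Lemma mpow_gens A r (g : 'I_r -> 'X_{1..n}) k m :
    (forall a, A a -> exists i, (g i <= a)%MM) -> mpow A k m ->
  exists v e, mdeg e = k /\ m = (v + gsum g e)%MM.
Proof.
move=> gA; elim: k m => [|k IH] m.
  move=> _; exists m, 0%MM; rewrite mdeg0; split=> //.
  by rewrite /gsum big1 ?addm0 // => i _; rewrite mnm0E.
move=> [a [b [/gA[i ia] /IH[v [e [de ->]]] ->]]].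
exists (a - g i + v)%MM, (U_(i) + e)%MM; rewrite mdegD mdeg1 de gsumD gsum1.
split=> //; apply/mnmP => j; move/mnm_lepP: ia => /(_ j).
by rewrite !(mnmDE, mnmBE); lia.
Qed.

(* The lifts [(v, e)] of the multiples [x0 + u] with [u] in [A ^ k : A] have
   finitely many minimal elements by Dickson's lemma; beyond their degrees a
   generator of [A] can be split off. *)
Lemma ratliff A : upclosed A -> (exists x, A x) -> exists k0, forall k u,
  (k0 <= k)%N -> (forall a, A a -> mpow A k.+1 (u + a)%MM) -> mpow A k u.
Proof.
move=> upA [x0 Ax0].
have [l [lA lle]] := @dickson _ _ (fun (i : 'I_n) (m : 'X_{1..n}) => m i) A.
pose r := size l; pose g (i : 'I_r) := tnth (in_tuple l) i.
have Ag i : A (g i) by apply: lA; apply: mem_tnth.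
have gA a : A a -> exists i, (g i <= a)%MM.
  move=> /lle[b /(tnthP (in_tuple l))[i ->] h]; exists i; exact/mnm_lepP.
pose P : set ('X_{1..n} * 'X_{1..r}) := [set t | exists u,
  (forall a, A a -> mpow A (mdeg t.2) (u + a)%MM) /\
  (x0 + u = t.1 + gsum g t.2)%MM].
pose x (i : 'I_n + 'I_r) (t : 'X_{1..n} * 'X_{1..r}) :=
  match i with inl j => t.1 j | inr j => t.2 j end.
have [L [LP Lle]] := dickson x P.
exists (\max_(t <- L) mdeg t.2)%N => k u k0 ku.
have [v [e [de uve]]] := mpow_gens gA (ku _ Ax0).
have /Lle[[v' e'] tL tle] : P (v, e).
  by exists u; rewrite /= de; split=> //; rewrite -uve addmC.
have [u' [/= Au' uve']] := LP _ tL.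
have v'v : (v' <= v)%MM by apply/mnm_lepP => i; apply: (tle (inl i)).
have e'e : (e' <= e)%MM by apply/mnm_lepP => i; apply: (tle (inr i)).
have de' : (mdeg e' <= k)%N.
  by apply: leq_trans k0; rewrite (big_rem (v', e')) //= leq_maxl.
have dd : mdeg (e - e')%MM = (k - mdeg e').+1.
  by have := congr1 (@mdeg r) (submK e'e); rewrite mdegD de -subSn // => <-; rewrite addnK.
have [i [f [ef df]]] := mdeg_gt0P dd.
(* The excess [e - e'] has degree at least 1. Its generator [g i] is the element of [A] that moves
   [u'] into the power [mdeg e']; the remaining [k - mdeg e'] generators supply the rest. *)
have -> : u = (u' + g i + (gsum g f + (v - v')))%MM.
  apply: (@addmI _ x0); rewrite [LHS]addmC uve -(submK v'v) -(submK e'e) ef !gsumD gsum1.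
  apply/mnmP => j; move/mnmP: uve' => /(_ j).
  by rewrite !(mnmDE, mnmBE); lia.
rewrite -(subnKC de'); apply: mpowD; first exact: Au'.
by apply: upclosed_mpow; rewrite -df; apply: mpow_gsum.
Qed.

End MonomialSets.

(** * Monomial ideals and their associated primes *)

Lemma least_min (P : set nat) d : P d -> P (least P) /\ (least P <= d)%N.
Proof.
move=> Pd; rewrite /least; case: xgetP => [e _ [Pe le_e]|nP]; first by split=> //; apply: le_e.
have ex : exists e, `[< P e >] by exists d; apply/asboolP.
case: (ex_minnP ex) => e /asboolP Pe le_e; case: (nP e); split=> // c Pc.
by apply: le_e; apply/asboolP.
Qed.

Section IdealFacts.
Variables (K : fieldType) (n : nat).
Local Notation S := {mpoly K[n]}.
Implicit Types (I L p : set S) (A B : set 'X_{1..n}) (f g : S).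

Lemma ideal_sum I (T : eqType) (r : seq T) (P : pred T) (F : T -> S) :
  is_ideal I -> (forall i, i \in r -> P i -> I (F i)) -> I (\sum_(i <- r | P i) F i).
Proof.
move=> [I0 ID _] IF; rewrite big_seq_cond.
by elim/big_ind: _ => // i /andP[ir Pi]; apply: IF.
Qed.

Lemma ideal_gen_is_ideal G : is_ideal (@ideal_gen K n G).
Proof.
split.
- by exists 0%N, (fun=> 0), (fun=> 0); split=> [[]//|]; rewrite big_ord0.
- move=> f g [r [c [h [Gh ->]]]] [r' [c' [h' [Gh' ->]]]].
  exists (r + r')%N, (fun i => match split i with inl j => c j | inr j => c' j end),
    (fun i => match split i with inl j => h j | inr j => h' j end).
  split=> [i|]; first by case: (split i).
  rewrite big_split_ord /=; congr (_ + _); apply: eq_bigr => i _.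
    by rewrite (unsplitK (inl i)).
  by rewrite (unsplitK (inr i)).
- move=> f g [r [c [h [Gh ->]]]]; exists r, (fun i => f * c i), h; split=> //.
  by rewrite mulr_sumr; apply: eq_bigr => i _; rewrite mulrA.
Qed.

Lemma sub_ideal_gen G f : G f -> @ideal_gen K n G f.
Proof. by exists 1%N, (fun=> 1), (fun=> f); split=> //; rewrite big_ord1 mul1r. Qed.

Lemma ideal_gen_sub G I : is_ideal I -> G `<=` I -> @ideal_gen K n G `<=` I.
Proof.
move=> idI GI f [r [c [h [Gh ->]]]]; apply: ideal_sum => // i _ _.
by case: (idI) => _ _; apply; apply: GI.
Qed.

Lemma idealB I f g : is_ideal I -> I f -> I g -> I (f - g).
Proof. by move=> [_ ID IM] If Ig; apply: ID => //; rewrite -mulN1r; apply: IM. Qed.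

Definition mono A : set S := [set f | forall m, m \in msupp f -> A m].

Lemma monoX A m : mono A 'X_[m] <-> A m.
Proof.
split=> [|Am m']; first by apply; rewrite msuppX mem_head.
by rewrite msuppX inE => /eqP ->.
Qed.

Lemma mono_is_ideal A : upclosed A -> is_ideal (mono A).
Proof.
move=> upA; split=> [m|f g Af Ag m|h f Af m]; first by rewrite msupp0.
  by move/msuppD_le; rewrite mem_cat => /orP[/Af|/Ag].
by move/msuppM_le => /allpairsP[[m1 m2] [_ /Af Am2 ->]] /=; rewrite addmC; apply: upA.
Qed.

Lemma mono_sub A I : is_ideal I -> (forall m, A m -> I 'X_[m]) -> mono A `<=` I.
Proof.
move=> idI AI f Af; rewrite [f]mpolyE; apply: ideal_sum => // m /Af Am _.
by rewrite -mul_mpolyC; case: (idI) => _ _; apply; apply: AI.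
Qed.

Lemma monomial_idealP I : monomial_ideal I -> exists2 A, upclosed A & I = mono A.
Proof.
move=> [M ->]; pose A : set 'X_{1..n} := [set m | exists2 a, M a & (a <= m)%MM].
have upA : upclosed A.
  by move=> m u [a Ma am]; exists a => //; exact: lepm_trans am (lem_addr _ _).
exists A => //.
rewrite eqEsubset; split.
  apply: ideal_gen_sub; first exact: mono_is_ideal.
  by move=> _ [m Mm <-]; apply/monoX; exists m => //; apply: lepm_refl.
apply: mono_sub; first exact: ideal_gen_is_ideal.
move=> m [a Ma /submK <-]; rewrite mpolyXD.
by case: (ideal_gen_is_ideal [set 'X_[m] | m in M]) => _ _; apply; apply: sub_ideal_gen; exists a.
Qed.

Lemma idealM_mono A B : upclosed A -> upclosed B ->
  idealM (mono A) (mono B) = mono (msum A B).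
Proof.
move=> upA upB; rewrite eqEsubset; split.
  apply: ideal_gen_sub; first by apply: mono_is_ideal; apply: upclosed_msum.
  move=> _ [f Af [g Bg <-]] m /msuppM_le /allpairsP[[a b] [/Af Aa /Bg Bb ->]] /=.
  by exists a, b.
apply: mono_sub; first exact: ideal_gen_is_ideal.
move=> _ [a [b [Aa Bb ->]]]; apply: sub_ideal_gen; exists 'X_[a]; first exact/monoX.
by exists 'X_[b]; [exact/monoX|rewrite mpolyXD].
Qed.

Lemma idealX_mono A k : upclosed A -> idealX (mono A) k = mono (mpow A k).
Proof.
move=> upA; elim: k => [|k IH] /=; first by rewrite eqEsubset; split.
by rewrite IH idealM_mono //; apply: upclosed_mpow.
Qed.

Lemma mono_colonX A u f : colon (mono A) 'X_[u] f <-> (forall m, m \in msupp f -> A (u + m)%MM).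
Proof.
rewrite /colon /mono /=; split=> h m.
  by move=> mf; apply: h; rewrite (perm_mem (msuppMX _ _)); apply: map_f.
by rewrite (perm_mem (msuppMX _ _)) => /mapP[m' /h ? ->].
Qed.

Definition varset (B : set 'I_n) : set 'X_{1..n} := [set w | exists2 i, B i & w i != 0%N].

Lemma upclosed_varset (B : set 'I_n) : upclosed (varset B).
Proof. by move=> m u [i Bi mi]; exists i => //; rewrite mnmDE addn_eq0 negb_and mi. Qed.

(** Modulo the ideal, both factors may be replaced by their parts free of the variables in [B]. The
    leading monomial of the product of these parts is the product of their leading monomials, hence
    again free of them. *)
Lemma varset_prime (B : set 'I_n) : prime_ideal (mono (varset B)).
Proof.
have idB := mono_is_ideal (upclosed_varset (B := B)).
split=> //.
  by move/(_ 0%MM); rewrite msupp1 mem_head => /(_ isT)[i _]; rewrite mnm0E.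
move=> f g fg; case: (pselect (mono (varset B) f)) => [|nf]; first by left.
case: (pselect (mono (varset B) g)) => [|ng]; first by right.
pose P m := `[< varset B m >].
have kB h : mono (varset B) (keep P h).
  by move=> m; rewrite mem_msupp_keep => /andP[/asboolP].
have nz h : ~ mono (varset B) h -> keep (predC P) h != 0.
  by move=> nh; apply/eqP => hz; apply: nh; rewrite (keep_split P h) hz addr0.
have lead h : ~ mono (varset B) h -> forall i, B i -> mlead (keep (predC P) h) i = 0%N.
  move=> /nz/mlead_supp; rewrite mem_msupp_keep => /andP[/asboolPn hn _] i Bi.
  by apply/eqP/contraT => hi; case: hn; exists i.
have : mono (varset B) (keep (predC P) f * keep (predC P) g).
  have -> : keep (predC P) f * keep (predC P) g =
    f * g - (g * keep P f + keep (predC P) f * keep P g).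
    have E (a b c d : S) : c * d = (a + c) * (b + d) - ((b + d) * a + c * b) by ring.
    by rewrite (E (keep P f) (keep P g)) -!keep_split.
  apply: (idealB (I := mono (varset B))) => //.
  by case: (idB) => _ ID IM; apply: ID; apply: IM.
have q0 : keep (predC P) f * keep (predC P) g != 0 by rewrite mulf_neq0 // nz.
move=> /(_ _ (mlead_supp q0)) [i Bi].
by rewrite mleadM ?nz // mnmDE !lead.
Qed.

End IdealFacts.

Section AssociatedPrimes.
Variables (K : fieldType) (n : nat).
Local Notation S := {mpoly K[n]}.
Variable A : set 'X_{1..n}.
Hypothesis upA : upclosed A.
Local Notation L := (mono (K := K) A).

(* Take [f] with minimal support.  If [g \in p] had a monomial outside [p], one
   could assume that no monomial of [g] is in [p]; multiplying [f] by the leading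
   monomial of [g] does not change the colon ideal but moves the leading monomial
   of [f] into [L], so that it can be dropped. *)
Lemma colon_prime_monomial (p : set S) f g w : prime_ideal p -> colon L f = p ->
  p g -> w \in msupp g -> p 'X_[w].
Proof.
move=> prp; have [idp p1 pM] := prp; have idL := mono_is_ideal K upA.
have [k] := ubnP (size (msupp f)); elim: k f => // k IH f; rewrite ltnS => sf cf pg wg.
pose P w := `[< p 'X_[w] >].
set g' := keep (predC P) g.
have pg' : p g'.
  have -> : g' = g - keep P g by rewrite {1}(keep_split P g) addrAC subrr add0r.
  apply: (idealB (I := p)) => //; rewrite /keep /lext.
  apply: (ideal_sum idp) => m _ _; rewrite -mul_mpolyC.
  have [p0 _ IM] := idp; apply: IM.
  by case: ifP => // /asboolP.
have [g0|gn0] := eqVneq g' 0.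
  have := mem_msupp_keep (predC P) g w; rewrite -/g' g0 msupp0 wg andbT /= => /esym.
  by move/negbFE/asboolP.
have vP : ~ p 'X_[mlead g'].
  by have := mlead_supp gn0; rewrite mem_msupp_keep => /andP[/asboolPn].
have fn0 : f != 0.
  by apply: contra_notN p1 => /eqP f0; rewrite -cf /colon /= f0 mulr0; case: idL.
set v := mlead g' in vP.
have Avf : A (v + mlead f)%MM.
  rewrite -mleadM //; have : L (g' * f) by rewrite -[L _]/(colon L f g') cf.
  by apply; rewrite mlead_supp // mulf_neq0.
pose Q m := ~~ `[< A m >]; set f2 := keep Q ('X_[v] * f).
apply: (IH f2) => //.
  have sub : {subset msupp f2 <= [seq (v + m)%MM | m <- rem (mlead f) (msupp f)]}.
    move=> m; rewrite mem_msupp_keep => /andP[/asboolPn nAm].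
    rewrite mulrC (perm_mem (msuppMX _ _)) => /mapP[m' m'f def]; subst m.
    apply: map_f; rewrite mem_rem_uniq ?msupp_uniq // inE m'f andbT.
    by apply: contra_notN nAm => /eqP ->.
  have := uniq_leq_size (msupp_uniq _) sub.
  rewrite [X in (_ <= X)%N]size_map (size_rem (mlead_supp fn0)).
  have : (0 < size (msupp f))%N by rewrite lt0n size_eq0 msupp_eq0.
  by move=> f_gt0 le_f2; apply: leq_ltn_trans le_f2 _; rewrite prednK.
have Lf2 h : L (h * f2) <-> L (h * 'X_[v] * f).
  have E : h * 'X_[v] * f = h * f2 + h * keep (predC Q) ('X_[v] * f).
    by rewrite -mulrDr -keep_split mulrA.
  have Lr : L (h * keep (predC Q) ('X_[v] * f)).
    case: (idL) => _ _; apply => m; rewrite mem_msupp_keep => /andP[].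
    by rewrite /= negbK => /asboolP.
  split=> [Lh|Lh]; first by rewrite E; case: idL => _ ID _; apply: ID.
  have -> : h * f2 = h * 'X_[v] * f - h * keep (predC Q) ('X_[v] * f).
    by rewrite E addrK.
  exact: (idealB idL).
rewrite eqEsubset; split=> h.
  move/Lf2; rewrite -/(colon L f (h * 'X_[v])) -[L _]/(colon L f (h * 'X_[v])) cf.
  by case/pM.
move=> ph; apply/Lf2; rewrite -[L _]/(colon L f (h * 'X_[v])) cf mulrC.
by case: idp => _ _; apply.
Qed.

(** As [p] contains the monomials of its elements, it kills every term of [f] modulo [L]. If each
    term had a strictly larger colon, the product of one witness per term would kill [f] and yet lie
    outside the prime [p]. *)
Lemma colon_prime_term (p : set S) f : prime_ideal p -> colon L f = p ->
  exists2 u, u \in msupp f & colon L 'X_[u] = p.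
Proof.
move=> prp cf; have [idp p1 pM] := prp; have idL := mono_is_ideal K upA.
have sub u g : u \in msupp f -> p g -> L (g * 'X_[u]).
  move=> uf pg; apply/mono_colonX => w wg.
  have : L ('X_[w] * f).
    rewrite -[L _]/(colon L f 'X_[w]) cf.
    exact: (colon_prime_monomial prp cf pg wg).
  apply; rewrite mulrC (perm_mem (msuppMX _ _)) addmC; exact: map_f.
apply: contrapT => no.
have bad u : u \in msupp f -> exists2 g, L (g * 'X_[u]) & ~ p g.
  move=> uf; apply: contrapT => nog; apply: no; exists u => //.
  rewrite eqEsubset; split=> g; last exact: sub.
  by move=> Lg; apply: contrapT => npg; apply: nog; exists g.
have {bad} : exists2 g, (forall u, u \in msupp f -> L (g * 'X_[u])) & ~ p g.
  elim: (msupp f) bad => [|v s IH] bad; first by exists 1.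
  have [g1 Lg1 pg1] := bad v (mem_head _ _).
  case: IH => [u us|g2 Lg2 pg2]; first by apply: bad; rewrite inE us orbT.
  exists (g1 * g2); last by case/pM.
  have [_ _ IM] := idL.
  move=> u; rewrite inE => /orP[/eqP ->|/Lg2 h].
    by rewrite [g1 * _]mulrC -mulrA; apply: IM.
  by rewrite -mulrA; apply: IM.
move=> [g Lg]; apply; rewrite -cf /colon /= [f]mpolyE mulr_sumr.
apply: (ideal_sum idL) => u uf _; rewrite -scalerAr -mul_mpolyC.
by case: idL => _ _; apply; apply: Lg.
Qed.

Definition var_colon (u : 'X_{1..n}) (B : set 'I_n) :=
  forall w, A (u + w)%MM <-> varset B w.

Lemma colon_var_colon u B : var_colon u B -> colon L 'X_[u] = mono (varset B).
Proof.
move=> uB; rewrite eqEsubset; split=> g.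
  by move/mono_colonX => h m mg; apply/uB; apply: h.
by move=> h; apply/mono_colonX => m mg; apply/uB; apply: h.
Qed.

(** Take [u] outside [A] that as many variables as possible move into [A]. If [u + w'] is outside
    [A] and [U_(i)] moves it into [A], then by maximality [U_(i)] already moves [u] into [A]. This
    shows that [Ass L] is nonempty, so [vnum] does not take its default value. *)
Lemma exists_var_colon : ~ A 0%MM -> exists u B, var_colon u B.
Proof.
move=> A0; pose N u := #|[set i : 'I_n | `[< A (u + U_(i))%MM >]]%SET|.
pose P k := `[< exists2 u, ~ A u & N u = k >].
have exP : exists k, P k by exists (N 0%MM); apply/asboolP; exists 0%MM.
have bP k : P k -> (k <= n)%N.
  by move/asboolP => [u _ <-]; rewrite -[X in (_ <= X)%N]card_ord max_card.
have [k /asboolP[u nu Nu] kmax] := ex_maxnP exP bP.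
exists u, [set i | A (u + U_(i))%MM] => w; split; last first.
  move=> [i /= Ai wi]; have Uw : (U_(i) <= w)%MM by rewrite lep1mP.
  by rewrite -(submK Uw) addmC -addmA addmC; apply: upA; rewrite addmC.
move dw: (mdeg w) => d; elim: d w dw => [|d IH] w.
  by move/eqP; rewrite mdeg_eq0 => /eqP ->; rewrite addm0.
move=> /mdeg_gt0P[i [w' [-> dw']]] Aw.
case: (pselect (A (u + w')%MM)) => [/(IH _ dw')[j Aj wj]|nA].
  by exists j => //; rewrite mnmDE addn_eq0 negb_and wj orbT.
exists i => /=; last by rewrite mnmDE mnm1E eqxx.
have sub : [set j : 'I_n | `[< A (u + U_(j))%MM >]]%SET \subset
    [set j : 'I_n | `[< A (u + w' + U_(j))%MM >]]%SET.
  apply/fintype.subsetP => j; rewrite !inE => Aj.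
  by rewrite -addmA [(w' + _)%MM]addmC addmA; apply: upA.
have : i \in [set j : 'I_n | `[< A (u + U_(j))%MM >]]%SET.
  suff /eqP -> : [set j : 'I_n | `[< A (u + U_(j))%MM >]]%SET ==
      [set j : 'I_n | `[< A (u + w' + U_(j))%MM >]]%SET.
    rewrite inE -addmA [(w' + _)%MM]addmC; exact/asboolP.
  rewrite eqEcard sub /=; change (N (u + w')%MM <= N u)%N; rewrite Nu.
  by apply: kmax; apply/asboolP; exists (u + w')%MM.
by rewrite inE => /asboolP.
Qed.

Lemma vnum_mono_le u B : var_colon u B -> (vnum L <= mdeg u)%N.
Proof.
move=> uB; have cu := colon_var_colon uB; set p := mono (varset B) in cu.
pose D := [set d | exists f : S, f \is d.-homog /\ colon L f = p].
have Du : D (mdeg u) by exists 'X_[u]; rewrite dhomogX.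
have [_ vp] := least_min Du.
apply: leq_trans vp; apply: (proj2 (least_min _)).
by exists p => //; split; [exact: varset_prime|exists 'X_[u]].
Qed.

Lemma vnum_mono_attained : ~ A 0%MM ->
  exists u B, mdeg u = vnum L /\ var_colon u B.
Proof.
move=> A0; have [u0 [B0 uB0]] := exists_var_colon A0.
have Ass0 : Ass L (mono (varset B0)).
  by split; [exact: varset_prime|exists 'X_[u0]; apply: colon_var_colon].
have [[p [prp [f0 cf0]] <-] _] : [set v_at p L | p in Ass L] (vnum L) /\ _ :=
  least_min (ex_intro2 _ _ _ Ass0 erefl).
(* [f0] may fail to be homogeneous; one of its terms shows that the set of degrees defining
   [v_at p L] is nonempty. *)
have [u1 _ cu1] := colon_prime_term prp cf0.
pose D := [set d | exists f : S, f \is d.-homog /\ colon L f = p].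
have Dd : D (mdeg u1) by exists 'X_[u1]; rewrite dhomogX.
have [[f [homf cf]] _] : D (v_at p L) /\ _ := least_min Dd.
have [u uf cu] := colon_prime_term prp cf.
exists u, [set i | p 'X_i]; split; first exact: (dhomog_mf homf uf).
have [idp p1 pM] := prp.
move=> w; have -> : A (u + w)%MM <-> p 'X_[w].
  by rewrite -cu -/(colon L 'X_[u] _) mono_colonX msuppX; split=> [? m|];
    [rewrite inE => /eqP ->|apply; rewrite mem_head].
split=> [|[i /= pi wi]]; last first.
  have Uw : (U_(i) <= w)%MM by rewrite lep1mP.
  by rewrite -(submK Uw) mpolyXD; case: idp => _ _; apply.
move dw: (mdeg w) => d; elim: d w dw => [|d IH] w.
  by move/eqP; rewrite mdeg_eq0 => /eqP ->; rewrite mpolyX0.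
move=> /mdeg_gt0P[i [w' [-> dw']]]; rewrite mpolyXD => /pM[pi|/(IH _ dw')[j pj wj]].
  by exists i => //; rewrite mnmDE mnm1E eqxx.
by exists j => //; rewrite mnmDE addn_eq0 negb_and wj orbT.
Qed.

End AssociatedPrimes.

(** * Sums of ideals in disjoint sets of variables *)

Section JoinMonomials.
Variables n m : nat.
Implicit Types (a : 'X_{1..n}) (b : 'X_{1..m}) (c : 'X_{1..n + m}).

Definition mjoin a b : 'X_{1..n + m} :=
  [multinom match split i with inl j => a j | inr j => b j end | i < n + m].

Definition mfst c : 'X_{1..n} := [multinom c (lshift m i) | i < n].
Definition msnd c : 'X_{1..m} := [multinom c (rshift n i) | i < m].

Lemma mjoin_lshift a b i : mjoin a b (lshift m i) = a i.
Proof. by rewrite mnmE (unsplitK (inl i)). Qed.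

Lemma mjoin_rshift a b i : mjoin a b (rshift n i) = b i.
Proof. by rewrite mnmE (unsplitK (inr i)). Qed.

Lemma mfst_join a b : mfst (mjoin a b) = a.
Proof. by apply/mnmP => i; rewrite mnmE mjoin_lshift. Qed.

Lemma msnd_join a b : msnd (mjoin a b) = b.
Proof. by apply/mnmP => i; rewrite mnmE mjoin_rshift. Qed.

Lemma mjoinK c : mjoin (mfst c) (msnd c) = c.
Proof.
by apply/mnmP => i; rewrite mnmE; case: splitP => j ij; rewrite mnmE;
  congr (c _); apply/val_inj.
Qed.

Lemma mfstD c c' : mfst (c + c')%MM = (mfst c + mfst c')%MM.
Proof. by apply/mnmP => i; rewrite !(mnmE, mnmDE). Qed.

Lemma msndD c c' : msnd (c + c')%MM = (msnd c + msnd c')%MM.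
Proof. by apply/mnmP => i; rewrite !(mnmE, mnmDE). Qed.

Lemma mjoinD a b a' b' : mjoin (a + a')%MM (b + b')%MM = (mjoin a b + mjoin a' b')%MM.
Proof.
by apply/mnmP => i; rewrite mnmDE !mnmE; case: split => j; rewrite mnmDE.
Qed.

Lemma mjoin0 : mjoin 0%MM 0%MM = 0%MM.
Proof. by apply/mnmP => i; rewrite mnmE mnm0E; case: split => j; rewrite mnm0E. Qed.

Lemma mjoin_split a b : mjoin a b = (mjoin a 0%MM + mjoin 0%MM b)%MM.
Proof. by rewrite -mjoinD addm0 add0m. Qed.

Lemma mdeg_join a b : mdeg (mjoin a b) = (mdeg a + mdeg b)%N.
Proof.
rewrite !mdegE big_split_ord /=; congr (_ + _)%N; apply: eq_bigr => i _.
  by rewrite mjoin_lshift.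
by rewrite mjoin_rshift.
Qed.

Definition mor (A : set 'X_{1..n}) (B : set 'X_{1..m}) : set 'X_{1..n + m} :=
  [set c | A (mfst c) \/ B (msnd c)].

Lemma upclosed_mor A B : upclosed A -> upclosed B -> upclosed (mor A B).
Proof.
move=> upA upB c u [Ac|Bc]; [left|right].
  by rewrite mfstD; apply: upA.
by rewrite msndD; apply: upB.
Qed.

(** This is the expansion of [(I + J)^k] as the sum of the [I^i J^j] with [i + j = k]; the variables
    being disjoint, membership splits into one condition on each component. *)
Lemma mpow_mor A B k c : upclosed A -> upclosed B -> mpow (mor A B) k c <->
  exists i j, [/\ (i + j)%N = k, mpow A i (mfst c) & mpow B j (msnd c)].
Proof.
move=> upA upB; split.
  elim: k c => [|k IH] c /=; first by exists 0%N, 0%N.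
  move=> [c1 [c2 [[h|h] /IH[i [j [<- ci cj]]] ->]]].
    exists i.+1, j; split=> //; first by exists (mfst c1), (mfst c2); rewrite mfstD.
    by rewrite msndD addmC; apply: upclosed_mpow.
  exists i, j.+1; split; first by rewrite addnS.
    by rewrite mfstD addmC; apply: upclosed_mpow.
  by exists (msnd c1), (msnd c2); rewrite msndD.
move=> [i [j [<- ci cj]]]; rewrite -(mjoinK c) mjoin_split; apply: mpowD.
  elim: i (mfst c) ci => //= i IH a [a1 [a2 [Aa1 Aa2 ->]]].
  exists (mjoin a1 0%MM), (mjoin a2 0%MM); split.
  - by left; rewrite mfst_join.
  - exact: IH.
  - by rewrite -mjoinD addm0.
elim: j (msnd c) cj => //= j IH b [b1 [b2 [Bb1 Bb2 ->]]].
exists (mjoin 0%MM b1), (mjoin 0%MM b2); split.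
- by right; rewrite msnd_join.
- exact: IH.
- by rewrite -mjoinD addm0.
Qed.

Variable K : fieldType.

Lemma inclxX a : inclx m 'X_[a] = 'X_[mjoin a 0%MM] :> {mpoly K[n + m]}.
Proof.
rewrite /inclx comp_mpolyX mpolyXE_id big_split_ord /= [X in _ * X]big1 => [|i _].
  by rewrite mulr1; apply: eq_bigr => i _; rewrite tnth_mktuple mjoin_lshift.
by rewrite mjoin_rshift mnm0E expr0.
Qed.

Lemma inclyX b : incly n 'X_[b] = 'X_[mjoin 0%MM b] :> {mpoly K[n + m]}.
Proof.
rewrite /incly comp_mpolyX mpolyXE_id big_split_ord /= [X in X * _]big1 => [|i _].
  by rewrite mul1r; apply: eq_bigr => i _; rewrite tnth_mktuple mjoin_rshift.
by rewrite mjoin_lshift mnm0E expr0.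
Qed.

Lemma mul_inclXX a b : inclx m 'X_[a] * incly n 'X_[b] = 'X_[mjoin a b] :> {mpoly K[n + m]}.
Proof. by rewrite inclxX inclyX -mpolyXD -mjoin_split. Qed.

Lemma inclxE p : inclx m p = \sum_(a <- msupp p) p@_a *: 'X_[mjoin a 0%MM] :> {mpoly K[n + m]}.
Proof.
rewrite {1}[p]mpolyE /inclx raddf_sum; apply: eq_bigr => a _.
by rewrite /= comp_mpolyZ -inclxX.
Qed.

Lemma inclyE p : incly n p = \sum_(b <- msupp p) p@_b *: 'X_[mjoin 0%MM b] :> {mpoly K[n + m]}.
Proof.
rewrite {1}[p]mpolyE /incly raddf_sum; apply: eq_bigr => a _.
by rewrite /= comp_mpolyZ -inclyX.
Qed.

Lemma extx_mono A : upclosed A -> extx m (mono (K := K) A) = mono [set c | A (mfst c)].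
Proof.
move=> upA; have upA' : upclosed [set c | A (mfst c)].
  by move=> c u Ac /=; rewrite mfstD; apply: upA.
have idA := mono_is_ideal K upA'.
rewrite eqEsubset; split.
  apply: ideal_gen_sub => // _ [f Af <-]; rewrite inclxE; apply: (ideal_sum idA) => a af _.
  rewrite -mul_mpolyC; case: idA => _ _; apply; apply/monoX; rewrite /= mfst_join.
  exact: Af.
apply: mono_sub; first exact: ideal_gen_is_ideal.
move=> c /= Ac; rewrite -(mjoinK c) mjoin_split addmC mpolyXD.
case: (ideal_gen_is_ideal [set inclx m f | f in mono (K := K) A]) => _ _; apply.
by apply: sub_ideal_gen; exists 'X_[mfst c]; rewrite ?inclxX //; apply/monoX.
Qed.

Lemma exty_mono B : upclosed B -> exty n (mono (K := K) B) = mono [set c | B (msnd c)].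
Proof.
move=> upB; have upB' : upclosed [set c | B (msnd c)].
  by move=> c u Bc /=; rewrite msndD; apply: upB.
have idB := mono_is_ideal K upB'.
rewrite eqEsubset; split.
  apply: ideal_gen_sub => // _ [f Bf <-]; rewrite inclyE; apply: (ideal_sum idB) => b bf _.
  rewrite -mul_mpolyC; case: idB => _ _; apply; apply/monoX; rewrite /= msnd_join.
  exact: Bf.
apply: mono_sub; first exact: ideal_gen_is_ideal.
move=> c /= Bc; rewrite -(mjoinK c) mjoin_split mpolyXD.
case: (ideal_gen_is_ideal [set incly n f | f in mono (K := K) B]) => _ _; apply.
by apply: sub_ideal_gen; exists 'X_[msnd c]; rewrite ?inclyX //; apply/monoX.
Qed.

Lemma idealD_mono A B : upclosed A -> upclosed B ->
  idealD (extx m (mono (K := K) A)) (exty n (mono B)) = mono (mor A B).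
Proof.
move=> upA upB; rewrite extx_mono // exty_mono // eqEsubset; split.
  move=> _ [f Af [g Bg <-]] c /msuppD_le; rewrite mem_cat => /orP[/Af|/Bg]; by [left|right].
move=> f ABf; pose P c := `[< A (mfst c) >].
exists (keep P f); first by move=> c; rewrite mem_msupp_keep => /andP[/asboolP].
exists (keep (predC P) f); last by rewrite -keep_split.
by move=> c; rewrite mem_msupp_keep => /andP[/asboolP nA /ABf[]].
Qed.

End JoinMonomials.

(** * The Koszul complex *)

(** This is [2 ^ k], written as a sum so that the block matrices of the recursion have the right
    size by conversion. *)
Fixpoint kdim k := if k is k'.+1 then (kdim k' + kdim k')%N else 1%N.

Fixpoint kcard k : 'I_(kdim k) -> nat :=
  if k is k'.+1 return 'I_(kdim k) -> nat then
    fun i => match split i with inl j => kcard j | inr j => (kcard j).+1 end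
  else fun=> 0%N.

(** The index of the empty exterior product, which is the top entry of a column. *)
Fixpoint ktop k : 'I_(kdim k) :=
  if k is k'.+1 return 'I_(kdim k) then lshift (kdim k') (ktop k') else ord0.

Lemma kcard_top k : kcard (ktop k) = 0%N.
Proof. by elim: k => //= k IH; rewrite (unsplitK (inl _)). Qed.

Lemma kcard_le k (i : 'I_(kdim k)) : (kcard i <= k)%N.
Proof. by elim: k i => //= k IH i; case: split => j; [apply: leqW|]; apply: IH. Qed.

(* Koszul differential of [x 0, ..., x (k - 1)] acting on column vectors: the
   upper half of a chain has no factor [e_(k-1)], the lower half has one. *)
Fixpoint kos (R : comNzRingType) (x : nat -> R) k : 'M[R]_(kdim k) :=
  if k is k'.+1 return 'M[R]_(kdim k) then
    block_mx (kos x k') (x k')%:M 0 (- kos x k')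
  else 0.

(** The diagonal matrix of the signs [(-1) ^ kcard i]. *)
Fixpoint ksgn (R : comNzRingType) k : 'M[R]_(kdim k) :=
  if k is k'.+1 return 'M[R]_(kdim k) then block_mx (ksgn R k') 0 0 (- ksgn R k')
  else 1%:M.

Section KoszulRing.
Variables (R : comNzRingType) (x : nat -> R).

Lemma kosS_col k r (c0 c1 : 'M[R]_(kdim k, r)) :
  kos x k.+1 *m col_mx c0 c1 = col_mx (kos x k *m c0 + x k *: c1) (- (kos x k *m c1)).
Proof. by rewrite /= mul_block_col mul0mx add0r mul_scalar_mx mulNmx. Qed.

Lemma kos_sq k : kos x k *m kos x k = 0.
Proof.
elim: k => [|k IH] /=; first by rewrite mul0mx.
rewrite mulmx_block !mulmx0 !mul0mx !mulmxN !mulNmx IH oppr0 addr0.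
by rewrite mul_mx_scalar mul_scalar_mx subrr oppr0 !addr0 block_mx0.
Qed.

Lemma ksgn_sq k : ksgn R k *m ksgn R k = 1%:M.
Proof.
elim: k => [|k IH] /=; first by rewrite mul1mx.
rewrite mulmx_block !mulmx0 !mul0mx !mulmxN !mulNmx IH !addr0 opprK add0r.
by rewrite -scalar_mx_block.
Qed.

Lemma ksgn_kos k : ksgn R k *m kos x k = - (kos x k *m ksgn R k).
Proof.
elim: k => [|k IH] /=; first by rewrite mulmx0 mul0mx oppr0.
rewrite !mulmx_block !mulmx0 !mul0mx !addr0 !add0r !mulmxN !mulNmx !opprK !IH.
by rewrite mul_mx_scalar mul_scalar_mx opp_block_mx !opprK oppr0.
Qed.

Lemma ksgn_diag k i j : i != j -> ksgn R k i j = 0.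
Proof.
elim: k i j => [|k IH] i j /=; first by rewrite [i]ord1 [j]ord1.
rewrite -[i]splitK -[j]splitK; case: (split i) => i' /=; case: (split j) => j' /=.
- by rewrite (inj_eq (@lshift_inj _ _)) block_mxEul; apply: IH.
- by rewrite block_mxEur mxE.
- by rewrite block_mxEdl mxE.
- by rewrite (inj_eq (@rshift_inj _ _)) block_mxEdr mxE => /IH ->; rewrite oppr0.
Qed.

Lemma kos_map (R' : comNzRingType) (f : {rmorphism R -> R'}) k :
  map_mx f (kos x k) = kos (f \o x) k.
Proof.
elim: k => [|k IH] /=; first by rewrite map_mx0.
by rewrite map_block_mx map_mxN map_mx0 map_scalar_mx IH.
Qed.

End KoszulRing.

Lemma eq_kos (R : comNzRingType) (x y : nat -> R) k :
  (forall i, (i < k)%N -> x i = y i) -> kos x k = kos y k.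
Proof.
elim: k => //= k IH xy; rewrite xy // IH // => i ik; apply: xy; exact: ltnW.
Qed.

Section KoszulMonomial.
Variables (K : fieldType) (n : nat) (u : nat -> 'X_{1..n}).
Local Notation S := {mpoly K[n]}.
Local Notation x := (fun i => 'X_[u i] : S).
Local Notation D k := (kos x k).

(* In a multidegree divisible by [u k'] the contraction is the cone with apex
   [e_k']; the other multidegrees are left to the remaining variables.  [kres]
   collects what no variable divides. *)
Fixpoint kcon k r : 'M[S]_(kdim k, r) -> 'M[S]_(kdim k, r) :=
  if k is k'.+1 return 'M[S]_(kdim k, r) -> 'M[S]_(kdim k, r) then
    fun c => col_mx (kcon (map_mx (keep (fun w => ~~ (u k' <= w)%MM)) (usubmx c)))
                    (map_mx (divm (u k')) (usubmx c))
  else fun=> 0.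

Fixpoint kres k r : 'M[S]_(kdim k, r) -> 'M[S]_(kdim k, r) :=
  if k is k'.+1 return 'M[S]_(kdim k, r) -> 'M[S]_(kdim k, r) then
    fun c => col_mx (kres (map_mx (keep (fun w => ~~ (u k' <= w)%MM)) (usubmx c))) 0
  else id.

Lemma map_keep_ndiv (v : 'X_{1..n}) p q (c : 'M[S]_(p, q)) :
  map_mx (keep (fun w => ~~ (v <= w)%MM)) c = c - 'X_[v] *: map_mx (divm v) c.
Proof. by apply/matrixP => i j; rewrite !mxE keep_ndiv. Qed.

Lemma map_divm_scale (v w : 'X_{1..n}) p q (c : 'M[S]_(p, q)) :
  (forall i, v i = 0%N \/ w i = 0%N) ->
  map_mx (divm v) ('X_[w] *: c) = 'X_[w] *: map_mx (divm v) c.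
Proof. by move=> vw; apply/matrixP => i j; rewrite 4!mxE divmMr. Qed.

Lemma map_divm_scaleK (v : 'X_{1..n}) p q (c : 'M[S]_(p, q)) :
  map_mx (divm v) ('X_[v] *: c) = c.
Proof. by apply/matrixP => i j; rewrite 2!mxE divmMl. Qed.

Lemma kos_divm (v : 'X_{1..n}) k r (c : 'M[S]_(kdim k, r)) :
  (forall l, (l < k)%N -> forall i, v i = 0%N \/ u l i = 0%N) ->
  map_mx (divm v) (D k *m c) = D k *m map_mx (divm v) c.
Proof.
elim: k c => [|k IH] c vu; first by rewrite /= !mul0mx map_mx0.
have vuk l : (l < k)%N -> forall i, v i = 0%N \/ u l i = 0%N.
  by move=> lk; apply: vu; exact: ltnW.
rewrite -(vsubmxK c) kosS_col 2!map_col_mx kosS_col map_mxD map_mxN !IH //.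
by rewrite map_divm_scale //; apply: vu.
Qed.

Lemma kconS_col k r (c0 c1 : 'M[S]_(kdim k, r)) :
  @kcon k.+1 r (col_mx c0 c1) =
  col_mx (kcon (map_mx (keep (fun w => ~~ (u k <= w)%MM)) c0)) (map_mx (divm (u k)) c0).
Proof. by rewrite [LHS]/= col_mxKu. Qed.

Lemma kresS_col k r (c0 c1 : 'M[S]_(kdim k, r)) :
  @kres k.+1 r (col_mx c0 c1) =
  col_mx (kres (map_mx (keep (fun w => ~~ (u k <= w)%MM)) c0)) 0.
Proof. by rewrite [LHS]/= col_mxKu. Qed.

(** Disjointness lets division by the last variable commute with the differential in the earlier
    ones. Hence dividing the upper half of [D c] gives [D e + c1], and the lower half [- D e] of
    [D (kcon c)] leaves [c1]. In the upper half, ['X_[u k] *: e] restores the multiples of the last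
    variable; the rest is the induction hypothesis. *)
Lemma kcon_homotopy k r (c : 'M[S]_(kdim k, r)) :
  (forall l l', (l < l' < k)%N -> forall i, u l' i = 0%N \/ u l i = 0%N) ->
  D k *m kcon c + kcon (D k *m c) = c - kres c.
Proof.
elim: k c => [|k IH] c dis; first by rewrite /= !mul0mx subrr addr0.
have disk l : (l < k)%N -> forall i, u k i = 0%N \/ u l i = 0%N.
  by move=> lk; apply: dis; rewrite lk ltnSn.
have disk' l l' : (l < l' < k)%N -> forall i, u l' i = 0%N \/ u l i = 0%N.
  by move=> /andP[ll' l'k]; apply: dis; rewrite ll' ltnW.
rewrite -(vsubmxK c); set c0 := usubmx c; set c1 := dsubmx c.
rewrite kconS_col kresS_col !kosS_col kconS_col.
set e := map_mx (divm _) c0.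
have eD : map_mx (divm (u k)) (D k *m c0 + 'X_[u k] *: c1) = D k *m e + c1.
  by rewrite map_mxD kos_divm // map_divm_scaleK.
have -> : map_mx (keep (fun w => ~~ (u k <= w)%MM)) (D k *m c0 + 'X_[u k] *: c1) =
    D k *m map_mx (keep (fun w => ~~ (u k <= w)%MM)) c0.
  rewrite !map_keep_ndiv eD mulmxBr -scalemxAr scalerDr opprD addrACA.
  by rewrite subrr addr0.
rewrite eD add_col_mx opp_col_mx add_col_mx oppr0 addr0 addrAC IH //; congr col_mx.
  by rewrite map_keep_ndiv -/e addrAC subrK.
by rewrite addrA addNr add0r.
Qed.

(** A nonzero entry of [kcon c] arises from an entry of [c] by dropping terms and dividing by a
    single variable, which costs one power by [mpow_divU]. *)
Lemma kcon_mono A a k r (c : 'M[S]_(kdim k, r)) :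
  (forall l, (l < k)%N -> exists i, u l = U_(i)%MM) ->
  (forall i j, mono (mpow A a.+1) (c i j)) -> forall i j, mono (mpow A a) (kcon c i j).
Proof.
elim: k c => [|k IH] c uU Ac i j; first by rewrite /= mxE => m; rewrite msupp0.
rewrite /= mxE; case: splitP => i' _.
  apply: IH => [l lk|i1 j1]; first by apply: uU; exact: ltnW.
  by rewrite !mxE => m; rewrite mem_msupp_keep => /andP[_]; apply: Ac.
rewrite !mxE => m; have [i0 ->] := uU k (ltnSn k).
by move=> /mem_msupp_divm /Ac; apply: mpow_divU.
Qed.

Lemma kresE k r (c : 'M[S]_(kdim k, r)) i j : exists2 P : pred 'X_{1..n},
  (forall m l, (l < k)%N -> P m -> ~~ (u l <= m)%MM) &
  kres c i j = if kcard i == 0%N then keep P (c i j) else 0.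
Proof.
elim: k c i => [|k IH] c i /=.
  exists predT => //.
  by apply/mpolyP => m; rewrite mcoeff_keep.
rewrite mxE; case: splitP => i' ii'; last first.
  by exists pred0 => //; rewrite mxE.
have [P PP ->] := IH (map_mx (keep (fun w => ~~ (u k <= w)%MM)) (usubmx c)) i'.
exists (fun m => P m && ~~ (u k <= m)%MM).
  move=> m l; rewrite ltnS leq_eqVlt => /orP[/eqP ->|lk] /andP[Pm]; first by [].
  by move=> _; apply: PP.
case: ifP => // _; rewrite !mxE.
have -> : lshift (kdim k) i' = i by apply/val_inj.
by apply/mpolyP => m; rewrite !mcoeff_keep; case: (P m).
Qed.

Lemma kosP k i j : (forall l, (l < k)%N -> mdeg (u l) = 1%N) -> D k i j != 0 ->
  kcard j = (kcard i).+1 /\ D k i j \is 1.-homog.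
Proof.
elim: k i j => [|k IH] i j u_deg /=; first by rewrite mxE eqxx.
have {}IH i' j' := IH i' j' (fun l lk => u_deg l (ltnW lk)).
rewrite -[i]splitK -[j]splitK; case: (split i) => i' /=; case: (split j) => j' /=.
- by rewrite block_mxEul !(unsplitK (inl _)); apply: IH.
- rewrite block_mxEur (unsplitK (inl _)) (unsplitK (inr _)) mxE.
  have [->|ij] := eqVneq i' j'; last by rewrite mulr0n eqxx.
  by move=> _; split=> //; rewrite mulr1n dhomogX; apply/eqP/(u_deg k).
- by rewrite block_mxEdl mxE eqxx.
- rewrite block_mxEdr !(unsplitK (inr _)) mxE oppr_eq0 => /IH[-> h].
  by rewrite dhomogN.
Qed.

Lemma kos_exact k r (c : 'M[S]_(kdim k, r)) :
  (forall l l', (l < l' < k)%N -> forall i, u l' i = 0%N \/ u l i = 0%N) ->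
  (forall m, m != 0%MM -> exists2 l, (l < k)%N & (u l <= m)%MM) ->
  D k *m c = 0 -> (forall i j, kcard i = 0%N -> (c i j)@_0%MM = 0) ->
  D k *m kcon c = c.
Proof.
move=> dis ucov Dc c0.
have kc0 : forall k r, @kcon k r 0 = 0.
  elim=> // k' IH r' /=; rewrite -[0](@col_mx0 _ (kdim k') (kdim k') r') col_mxKu.
  by rewrite !map_mx0 IH.
have := kcon_homotopy c dis; rewrite Dc kc0 addr0 => ->.
suff -> : kres c = 0 by rewrite subr0.
apply/matrixP => i j; rewrite [RHS]mxE.
have [P PP ->] := kresE c i j; case: eqP => // ki.
apply/mpolyP => m; rewrite mcoeff_keep mcoeff0; case: ifP => // Pm.
have [->|/ucov[l lk]] := eqVneq m 0%MM; first exact: c0.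
by rewrite (negbTE (PP _ _ lk Pm)).
Qed.

End KoszulMonomial.

(** * Koszul homology and minimal resolutions *)

Section GradedParts.
Variables (K : fieldType) (n : nat).
Local Notation S := {mpoly K[n]}.

Lemma mcoeff0_mul (f g : S) : (f * g)@_0%MM = f@_0%MM * g@_0%MM.
Proof. exact: (rmorphM (@mcoeff n K 0%MM)). Qed.

Lemma mulmx_mcoeff0r p q r (c : 'M[S]_(p, q)) (N : 'M[S]_(q, r)) i b :
  (forall a, (N a b)@_0%MM = 0) -> ((c *m N) i b)@_0%MM = 0.
Proof.
by move=> N0; rewrite mxE raddf_sum big1 //= => a _; rewrite mcoeff0_mul N0 mulr0.
Qed.

Lemma mulmx_mcoeff0l p q r (N : 'M[S]_(p, q)) (c : 'M[S]_(q, r)) i b :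
  (forall a, (N i a)@_0%MM = 0) -> ((N *m c) i b)@_0%MM = 0.
Proof.
by move=> N0; rewrite mxE raddf_sum big1 //= => a _; rewrite mcoeff0_mul N0 mul0r.
Qed.

(** The component of degree [d] in [S(-q)]. *)
Definition gpart (q d : nat) : S -> S := keep (fun w => mdeg w + q == d)%N.

HB.instance Definition _ q d := GRing.Linear.on (gpart q d).

Lemma gpart_mul e q d (g f : S) : g \is e.-homog ->
  gpart q d (g * f) = g * gpart (q + e) d f.
Proof.
move=> /dhomog_mf homg.
rewrite {1}[g]mpolyE mulr_suml raddf_sum [g in RHS]mpolyE mulr_suml /=.
apply: eq_big_seq => w /homg dw; rewrite -!scalerAl linearZ /=; congr (_ *: _).
apply: (@eq_linear_mpoly _ _ _ (fun f => gpart q d ('X_[w] * f))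
  (fun f => 'X_[w] * gpart (q + e) d f)) => [c h h'|c h h'|m].
- by rewrite mulrDr -scalerAr linearP.
- by rewrite linearP mulrDr -scalerAr.
rewrite -mpolyXD /gpart !keepX mdegD -dw [(mdeg m + _)%N]addnC.
have -> : (mdeg w + mdeg m + q = q + mdeg w + mdeg m)%N by lia.
by case: eqP; rewrite ?mpolyXD ?mulr0.
Qed.

Lemma gpart_id q d f : (forall m, m \in msupp f -> (mdeg m + q)%N = d) -> gpart q d f = f.
Proof.
move=> fd; apply/mpolyP => m; rewrite mcoeff_keep.
case: (boolP (m \in msupp f)) => [/fd ->|/memN_msupp_eq0 ->]; first by rewrite eqxx.
by case: ifP.
Qed.

Lemma gpart_mono A q d f : mono A f -> mono A (gpart q d f).
Proof. by move=> Af m; rewrite mem_msupp_keep => /andP[_ /Af]. Qed.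

(* The component of a chain in Koszul degree [p] and internal degree [d], where
   the basis vector [a] of the coefficient module has degree [dg a]. *)
Definition hpart k r (dg : 'I_r -> nat) p d (c : 'M[S]_(kdim k, r)) : 'M[S]_(kdim k, r) :=
  \matrix_(i, a) if kcard i == p then gpart (p + dg a) d (c i a) else 0.

Lemma hpart_id k r (dg : 'I_r -> nat) p d (c : 'M[S]_(kdim k, r)) :
  hpart dg p d (hpart dg p d c) = hpart dg p d c.
Proof.
apply/matrixP => i a; rewrite !mxE; case: (kcard i == p) => //.
by apply/mpolyP => m; rewrite !mcoeff_keep; case: (_ == d).
Qed.

Lemma hpart_mulr k r r' (dg : 'I_r -> nat) (dg' : 'I_r' -> nat) p d
    (c : 'M[S]_(kdim k, r)) (N : 'M[S]_(r, r')) :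
  (forall a b, N a b != 0 -> exists2 e, dg a = (dg' b + e)%N & N a b \is e.-homog) ->
  hpart dg p d c *m N = hpart dg' p d (c *m N).
Proof.
move=> homN; apply/matrixP => i b; rewrite !mxE.
case: (boolP (kcard i == p)) => ip; last first.
  by rewrite big1 // => a _; rewrite mxE (negbTE ip) mul0r.
rewrite raddf_sum; apply: eq_bigr => a _; rewrite mxE ip /=.
have [->|/homN[e -> he]] := eqVneq (N a b) 0; first by rewrite !mulr0 raddf0.
by rewrite mulrC [in RHS]mulrC (gpart_mul _ _ _ he) addnA.
Qed.

Lemma hpart_kos u k r (dg : 'I_r -> nat) p d (c : 'M[S]_(kdim k, r)) :
  (forall l, (l < k)%N -> mdeg (u l) = 1%N) ->
  kos (fun i => 'X_[u i]) k *m hpart dg p.+1 d c =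
  hpart dg p d (kos (fun i => 'X_[u i]) k *m c).
Proof.
move=> u1; apply/matrixP => i a; rewrite !mxE.
case: (boolP (kcard i == p)) => ip; last first.
  rewrite big1 // => j _; rewrite mxE.
  have [->|/(kosP u1)[-> _]] := eqVneq (kos (fun i => 'X_[u i] : S) k i j) 0.
    by rewrite mul0r.
  by rewrite eqSS (negbTE ip) mulr0.
rewrite raddf_sum; apply: eq_bigr => j _; rewrite mxE /=.
have [->|/(kosP u1)[-> he]] := eqVneq (kos (fun i => 'X_[u i] : S) k i j) 0.
  by rewrite !mul0r raddf0.
by rewrite eqSS ip (gpart_mul _ _ _ he) addn1 addSn.
Qed.

Lemma kos_hpart0 u k r (dg : 'I_r -> nat) d (c : 'M[S]_(kdim k, r)) :
  (forall l, (l < k)%N -> mdeg (u l) = 1%N) -> kos (fun i => 'X_[u i]) k *m hpart dg 0 d c = 0.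
Proof.
move=> u1; apply/matrixP => i a; rewrite !mxE big1 // => l _; rewrite mxE.
have [->|/(kosP u1)[-> _]] := eqVneq (kos (fun i => 'X_[u i] : S) k i l) 0.
  by rewrite mul0r.
by rewrite mulr0.
Qed.

Lemma hpart_cycle u k r (dg : 'I_r -> nat) p d (c : 'M[S]_(kdim k, r)) :
  (forall l, (l < k)%N -> mdeg (u l) = 1%N) -> kos (fun i => 'X_[u i]) k *m c = 0 ->
  kos (fun i => 'X_[u i]) k *m hpart dg p d c = 0.
Proof.
case: p => [|p] u1 Dc; first exact: kos_hpart0.
rewrite hpart_kos // Dc; apply/matrixP => i a; rewrite !mxE.
by case: ifP; rewrite ?raddf0.
Qed.

End GradedParts.

(* [u 0], ..., [u (k - 1)] are the variables in some order.  [zigzag c z] is a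
   staircase in the double complex of Koszul chains with coefficients in [F],
   from [c] over [F_i] down to [z] over [L]; it identifies the generators of
   [F_i] with Koszul homology classes of [L] in degree [i].  [hzigzag p d c z]
   asks in addition for internal degree [d] and Koszul degree [p] at [c]. *)
Section Zigzag.
Variables (K : fieldType) (n : nat).
Local Notation S := {mpoly K[n]}.
Variables (u : nat -> 'X_{1..n}) (k : nat).
Hypothesis u_deg : forall l, (l < k)%N -> mdeg (u l) = 1%N.
Hypothesis u_dis : forall l l', (l < l' < k)%N -> forall i, u l' i = 0%N \/ u l i = 0%N.
Hypothesis u_cov : forall m : 'X_{1..n}, m != 0%MM -> exists2 l, (l < k)%N & (u l <= m)%MM.
Local Notation D := (kos (fun i => 'X_[u i] : S) k).
Variables (L : set S) (F : min_graded_free_res L).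

Fixpoint zigzag i (c : 'M[S]_(kdim k, rk F i)) (z : 'cV[S]_(kdim k)) : Prop :=
  match i return 'M[S]_(kdim k, rk F i) -> Prop with
  | 0%N => fun c => z = c *m aug F
  | i'.+1 => fun c => exists c' : 'M[S]_(kdim k, rk F i'), D *m c' = c *m dif F i' /\ zigzag c' z
  end c.

Fixpoint hzigzag p d i (c : 'M[S]_(kdim k, rk F i)) (z : 'cV[S]_(kdim k)) : Prop :=
  hpart (@dg _ _ _ F i) p d c = c /\
  match i return 'M[S]_(kdim k, rk F i) -> Prop with
  | 0%N => fun c => z = c *m aug F
  | i'.+1 => fun c => exists c' : 'M[S]_(kdim k, rk F i'),
      D *m c' = c *m dif F i' /\ hzigzag p.+1 d c' z
  end c.

Lemma aug_deg a (b : 'I_1) : aug F a b != 0 ->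
  exists2 e, dg a = (0 + e)%N & aug F a b \is e.-homog.
Proof. by move=> _; exists (dg a); rewrite ?add0n // [b]ord1; apply: aug_homog. Qed.

(** All maps are homogeneous, so components of a staircase form a staircase. Each step down the
    resolution raises the Koszul degree by one and keeps the internal degree. *)
Lemma zigzag_hpart p d i (c : 'M[S]_(kdim k, rk F i)) z : zigzag c z ->
  hzigzag p d (hpart (@dg _ _ _ F i) p d c) (hpart (fun=> 0%N) (p + i)%N d z).
Proof.
elim: i p c => [|i IH] p c /=.
  by move=> ->; rewrite hpart_id addn0 -(hpart_mulr _ _ _ aug_deg).
move=> [c' [Dc' /(IH p.+1) zz]]; rewrite hpart_id; split=> //.
exists (hpart (@dg _ _ _ F i) p.+1 d c'); split; last by rewrite -addSnnS.
by rewrite hpart_kos // Dc' (hpart_mulr _ _ _ (@dif_homog _ _ _ F i)).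
Qed.

Lemma hzigzagW p d i (c : 'M[S]_(kdim k, rk F i)) z : hzigzag p d c z -> zigzag c z.
Proof.
elim: i p c => [|i IH] p c /=; first by case.
by move=> [_ [c' [Dc' /IH zz]]]; exists c'.
Qed.

Lemma lift_dif i r (c : 'M[S]_(r, rk F i.+1)) : c *m dif F i = 0 ->
  exists b : 'M[S]_(r, rk F i.+2), c = b *m dif F i.+1.
Proof.
move=> c0; have /choice[b bP] : forall j : 'I_r, exists w : 'rV[S]_(rk F i.+2),
    row j c = w *m dif F i.+1.
  by move=> j; apply/exact_dif; rewrite -row_mul c0 row0.
exists (\matrix_j b j); apply/row_matrixP => j.
by rewrite row_mul rowK.
Qed.

Lemma lift_dif0 r (c : 'M[S]_(r, rk F 0)) : c *m aug F = 0 ->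
  exists b : 'M[S]_(r, rk F 1), c = b *m dif F 0.
Proof.
move=> c0; have /choice[b bP] : forall j : 'I_r, exists w : 'rV[S]_(rk F 1),
    row j c = w *m dif F 0.
  by move=> j; apply/exact_aug; rewrite -row_mul c0 row0.
exists (\matrix_j b j); apply/row_matrixP => j.
by rewrite row_mul rowK.
Qed.

Lemma lift_aug r (z : 'cV[S]_r) : (forall j, L (z j 0)) ->
  exists b : 'M[S]_(r, rk F 0), z = b *m aug F.
Proof.
move=> Lz; have /choice[b bP] : forall j : 'I_r, exists w : 'rV[S]_(rk F 0),
    (w *m aug F) 0 0 = z j 0.
  by move=> j; apply/(aug_image F).
exists (\matrix_j b j); apply/colP => j; rewrite -bP.
have := congr1 (fun M : 'rV_1 => M 0 0) (row_mul j (\matrix_j b j) (aug F)).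
by rewrite rowK mxE.
Qed.

Lemma aug_mem r (b : 'M[S]_(r, rk F 0)) j : L ((b *m aug F) j 0).
Proof.
apply/(aug_image F); exists (row j b).
by rewrite -row_mul mxE.
Qed.

Lemma dif_aug : dif F 0 *m aug F = 0.
Proof.
apply/row_matrixP => a; rewrite row_mul row0; apply/exact_aug.
by exists (delta_mx 0 a); rewrite -rowE.
Qed.

Lemma dif_dif i : dif F i.+1 *m dif F i = 0.
Proof.
apply/row_matrixP => a; rewrite row_mul row0; apply/exact_dif.
by exists (delta_mx 0 a); rewrite -rowE.
Qed.

Lemma kos_boundary r (c : 'M[S]_(kdim k, r)) : D *m c = 0 ->
  (forall i j, kcard i = 0%N -> (c i j)@_0%MM = 0) -> exists y, D *m y = c.
Proof. by move=> Dc c0; exists (kcon u c); apply: kos_exact. Qed.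

(** By minimality [c *m dif F i] has no constant terms, so this Koszul cycle is a boundary and the
    staircase continues. *)
Lemma zigzag_down i (c : 'M[S]_(kdim k, rk F i)) b :
  D *m c = b *m dif F i -> exists2 z, zigzag c z & D *m z = 0.
Proof.
elim: i c b => [|i IH] c b Dc.
  by exists (c *m aug F) => //; rewrite mulmxA Dc -mulmxA dif_aug mulmx0.
have [||c' Dc'] := @kos_boundary _ (c *m dif F i).
- by rewrite mulmxA Dc -mulmxA dif_dif mulmx0.
- by move=> j a _; apply: mulmx_mcoeff0r => b'; apply: dif_minimal.
by have [z zz Dz] := IH c' c Dc'; exists z => //; exists c'.
Qed.

(** A primitive of [z] over [L] is lifted up the staircase; at each step the defect lies in the
    kernel of a map of the resolution and lifts by exactness. *)
Lemma zigzag_boundary i (c : 'M[S]_(kdim k, rk F i)) z (y : 'cV[S]_(kdim k)) :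
  zigzag c z -> z = D *m y -> (forall j, L (y j 0)) ->
  exists b g, c = D *m b + g *m dif F i.
Proof.
move=> zz zy Ly; elim: i c zz => [|i IH] c /=.
  have [y0 ey] := lift_aug Ly; rewrite zy ey mulmxA => /esym/eqP.
  rewrite -subr_eq0 -mulmxBl => /eqP/lift_dif0[g eg].
  by exists y0, g; rewrite -eg addrC subrK.
move=> [c' [Dc' /IH[b [g eg]]]].
have : (c - D *m g) *m dif F i = 0.
  by rewrite mulmxBl -Dc' eg mulmxDr mulmxA kos_sq mul0mx add0r mulmxA subrr.
move=> /lift_dif[h eh]; exists g, h; by rewrite -eh addrC subrK.
Qed.

Lemma zigzag_up i (z : 'cV[S]_(kdim k)) : (forall j, L (z j 0)) -> D *m z = 0 ->
  exists c b, zigzag (i := i) c z /\ D *m c = b *m dif F i.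
Proof.
move=> Lz Dz; elim: i => [|i [c [b [zz Dc]]]].
  have [c ec] := lift_aug Lz.
  have [|b eb] := @lift_dif0 _ (D *m c); first by rewrite -mulmxA -ec.
  by exists c, b.
have [|b' eb] := @lift_dif i _ (D *m b).
  by rewrite -mulmxA -Dc mulmxA kos_sq mul0mx.
by exists b, b'; split=> //; exists c.
Qed.

(** On the way down, the cycle [c' - y *m dif F i] bounds because it has no constant terms in Koszul
    degree 0: [c'] lives in positive Koszul degree and [dif F i] is minimal. Hence the graded form
    of the staircase. *)
Lemma hzigzag_boundary p d i (c : 'M[S]_(kdim k, rk F i)) z y g :
  hzigzag p d c z -> c = D *m y + g *m dif F i ->
  exists2 y0, z = D *m y0 & forall j, L (y0 j 0).
Proof.
elim: i p c y g => [|i IH] p c y g /=.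
  move=> [_ ->] ->; exists (y *m aug F); last by move=> j; apply: aug_mem.
  by rewrite mulmxDl -mulmxA -mulmxA dif_aug mulmx0 addr0.
move=> [_ [c' [Dc' zz]]] ec.
have hc' : hpart (@dg _ _ _ F i) p.+1 d c' = c' by case: (i) c' zz {Dc' ec IH} => [|?] ? [].
have [||y' ey'] := @kos_boundary _ (c' - y *m dif F i).
- rewrite mulmxBr Dc' ec mulmxDl -[_ *m dif F i.+1 *m _]mulmxA dif_dif mulmx0 addr0.
  by rewrite mulmxA subrr.
- move=> j a kj; rewrite -hc' !mxE kj /= sub0r mcoeffN.
  have := @mulmx_mcoeff0r _ _ _ _ _ y (dif F i) j a (fun b => dif_minimal b a).
  by rewrite mxE => ->; rewrite oppr0.
by apply: (IH _ _ y' y zz); rewrite ey' subrK.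
Qed.

Lemma zigzag_mem i (c : 'M[S]_(kdim k, rk F i)) z j : zigzag c z -> L (z j 0).
Proof.
by elim: i c => [c -> | i IH c [c' [_ /IH]]] //; apply: aug_mem.
Qed.

(** The staircase starts at the basis vector [a] in Koszul degree 0. Were [z] a boundary over [L],
    that vector would be a combination through [D] and [dif F i], whose entries have no constant
    term, although its coefficient is 1. *)
Lemma koszul_class_of_generator i (a : 'I_(rk F i)) :
  exists z : 'cV[S]_(kdim k), [/\ forall j, L (z j 0), D *m z = 0,
    hpart (fun=> 0%N) i (dg a) z = z &
    forall y : 'cV[S]_(kdim k), (forall j, L (y j 0)) -> z <> D *m y].
Proof.
pose c : 'M[S]_(kdim k, rk F i) := delta_mx (ktop k) a.
have Dc : D *m c = 0 *m dif F i.
  rewrite mul0mx; apply/matrixP => j b; rewrite !mxE big1 // => l _; rewrite mxE.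
  have [->|] := eqVneq l (ktop k); last by rewrite mulr0.
  have [->|/(kosP u_deg)[]] := eqVneq (D j (ktop k)) 0; first by rewrite mul0r.
  by rewrite kcard_top.
have [z0 zz0 Dz0] := zigzag_down Dc.
have hc : hpart (@dg _ _ _ F i) 0 (dg a) c = c.
  apply/matrixP => j b; rewrite !mxE.
  have [->|] := eqVneq j (ktop k); last by case: ifP; rewrite ?raddf0.
  rewrite kcard_top eqxx /=; have [->|] := eqVneq b a; last by rewrite raddf0.
  by apply: gpart_id => m; rewrite msupp1 inE => /eqP ->; rewrite mdeg0.
have := zigzag_hpart 0 (dg a) zz0; rewrite hc add0n.
set z := hpart _ _ _ z0 => zz; exists z; split.
- by move=> j; apply: zigzag_mem (hzigzagW zz).
- exact: hpart_cycle.
- by rewrite /z hpart_id.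
move=> y Ly ezy; have [b [g eg]] := zigzag_boundary (hzigzagW zz) ezy Ly.
have := congr1 (fun M : 'M[S]__ => (M (ktop k) a)@_0%MM) eg.
rewrite [in LHS]mxE !eqxx mxE mcoeffD /= mcoeff1 eqxx.
rewrite mulmx_mcoeff0l => [|j]; last first.
  have [->|/(kosP u_deg)[_ h]] := eqVneq (D (ktop k) j) 0; first exact: mcoeff0.
  by apply: (dhomog_nemf_coeff h); rewrite /= mdeg0.
rewrite mulmx_mcoeff0r => [|b']; last exact: dif_minimal.
by move/eqP; rewrite addr0 oner_eq0.
Qed.

(** The top [c] of a staircase above [z] has Koszul degree 0 and internal degree [d]. With no basis
    vector of degree [d] it has no constant terms, so it bounds, and then so does [z]. *)
Lemma generator_of_koszul_class i d (z : 'cV[S]_(kdim k)) :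
    (forall j, L (z j 0)) -> D *m z = 0 -> hpart (fun=> 0%N) i d z = z ->
    (forall y : 'cV[S]_(kdim k), (forall j, L (y j 0)) -> z <> D *m y) ->
  exists a : 'I_(rk F i), dg a = d.
Proof.
move=> Lz Dz hz nz; have [c0 [b [zz0 Dc0]]] := zigzag_up i Lz Dz.
have := zigzag_hpart 0 d zz0; rewrite add0n hz.
set c := hpart _ _ _ c0 => zz.
apply: contrapT => nodeg.
have [||y ey] := @kos_boundary _ c.
- exact: kos_hpart0.
- move=> j a j0; rewrite mxE j0 eqxx mcoeff_keep mdeg0 add0n add0n.
  by case: eqP => // ad; case: nodeg; exists a.
have ec : c = D *m y + 0 *m dif F i by rewrite ey mul0mx addr0.
by have [y0 /nz] := hzigzag_boundary zz ec.
Qed.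

End Zigzag.

(** * Existence of minimal resolutions *)

Section Noetherian.
Variables (K : fieldType) (n : nat).
Local Notation S := {mpoly K[n]}.

Definition submodule r (M : set 'rV[S]_r) :=
  [/\ M 0, forall v w, M v -> M w -> M (v + w) & forall (f : S) v, M v -> M (f *: v)].

Definition generates t r (M : set 'rV[S]_r) (G : 'M[S]_(t, r)) :=
  forall v, M v <-> exists w : 'rV[S]_t, v = w *m G.

Lemma submodule_mulmx t r (M : set 'rV[S]_r) (G : 'M[S]_(t, r)) (w : 'rV_t) :
  submodule M -> (forall i, M (row i G)) -> M (w *m G).
Proof.
move=> [M0 MD MZ] MG; rewrite mulmx_sum_row.
by elim/big_ind: _ => // i _; apply: MZ.
Qed.

Lemma mlead_sub_lt (f q : S) : f != 0 -> mlead q = mlead f ->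
  q@_(mlead q) = f@_(mlead f) -> f - q != 0 -> (mlead (f - q) < mlead f)%O.
Proof.
move=> f0 qf cqf fq0; have := mleadB_le f q; rewrite qf Order.JoinTheory.joinxx => le.
rewrite Order.POrderTheory.lt_neqAle le andbT; apply: contra fq0 => /eqP e.
by rewrite -mleadc_eq0 e mcoeffB -cqf qf subrr.
Qed.

(** Hilbert's basis theorem by a Groebner basis: Dickson's lemma on leading monomials, then
    reduction of leading terms along the well-founded monomial order. *)
Lemma ideal_fg (I : set S) : is_ideal I -> exists t (g : 'I_t -> S),
  (forall j, I (g j)) /\ (forall f, I f -> exists w : 'I_t -> S, f = \sum_j w j * g j).
Proof.
move=> idI.
have [l [lI lle]] := dickson (fun (i : 'I_n) (f : S) => mlead f i) [set f | I f /\ f != 0].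
exists (size l), (fun j => tnth (in_tuple l) j); split=> [j|f].
  by have [] := lI _ (mem_tnth j (in_tuple l)).
move dm: (mlead f) => m; elim/(well_founded_ind (@ltom_wf n)): m f dm => m IH f dm If.
have [->|f0] := eqVneq f 0; first by exists (fun=> 0); rewrite big1 // => j _; rewrite mul0r.
have [g gl gf] := lle f (conj If f0); have [Ig g0] := lI g gl.
have [j gj] := tnthP (in_tuple l) _ gl.
pose c := f@_(mlead f) / g@_(mlead g).
have c0 : c != 0 by rewrite mulf_neq0 ?invr_eq0 ?mleadc_eq0.
pose h := c *: 'X_[mlead f - mlead g] : S.
have le : (mlead g <= mlead f)%MM by apply/mnm_lepP.
have h0 : h != 0 by rewrite /h mscalerI negb_or c0 -msize_poly_eq0 msizeX.
have lq : mlead (h * g) = mlead f by rewrite mleadM // /h mleadZ // mleadXm submK.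
have cq : (h * g)@_(mlead (h * g)) = f@_(mlead f).
  rewrite mleadM // mleadcM /h mleadZ // mleadXm mcoeffZ mcoeffX eqxx mulr1.
  by rewrite divfK // mleadc_eq0.
have Iq : I (f - h * g) by apply: (idealB idI) => //; case: idI => _ _; apply.
have [w ew] : exists w : 'I_(size l) -> S, f - h * g = \sum_j w j * tnth (in_tuple l) j.
  have [->|q0] := eqVneq (f - h * g) 0.
    by exists (fun=> 0); rewrite big1 // => i _; rewrite mul0r.
  by apply: (IH (mlead (f - h * g))) => //; rewrite -dm; apply: mlead_sub_lt.
exists (fun i => w i + (if i == j then h else 0)).
rewrite -[LHS](subrK (h * g)) ew.
under [RHS]eq_bigr do rewrite mulrDl.
rewrite big_split /=; congr (_ + _).
by rewrite (bigD1 j) //= eqxx -gj big1 ?addr0 // => i /negbTE ->; rewrite mul0r.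
Qed.

(** Induction on the rank: lifts of generators of the ideal of first coordinates, together with
    generators of the part whose first coordinate vanishes. *)
Lemma submodule_fg r (M : set 'rV[S]_r) : submodule M ->
  exists t (G : 'M[S]_(t, r)), generates M G.
Proof.
elim: r M => [|r IH] M [M0 MD MZ].
  exists 0%N, 0 => v; rewrite [v]thinmx0; split=> // _.
  by exists 0; rewrite mulmx0.
pose I : set S := [set f | exists v, M (row_mx (f%:M : 'M_1) v : 'rV_(1 + r))].
have idI : is_ideal I.
  split; first by exists 0; rewrite raddf0 row_mx0.
    by move=> f g [v Mv] [w Mw]; exists (v + w); rewrite raddfD -add_row_mx; apply: MD.
  move=> h f [v Mv]; exists (h *: v).
  by rewrite -scale_scalar_mx -scale_row_mx; apply: MZ.
have [t1 [g [Ig gI]]] := ideal_fg idI.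
have /choice[V MV] := Ig.
pose N : set 'rV[S]_r := [set v | M (row_mx 0 v : 'rV_(1 + r))].
have [|t2 [G2 genG2]] := IH N.
  split; first by rewrite /N /= row_mx0.
    by move=> v w Nv Nw; rewrite /N /= -[X in row_mx X _](addr0 0) -add_row_mx; apply: MD.
  by move=> f v Nv; rewrite /N /= -[X in row_mx X _](scaler0 _ f) -scale_row_mx; apply: MZ.
pose G : 'M[S]_(t1 + t2, 1 + r) := col_mx (row_mx (\col_j g j) (\matrix_j V j)) (row_mx 0 G2).
have rowG i : M (row i G).
  case: (splitP i) => j ij.
    rewrite (_ : i = lshift t2 j); last exact/val_inj.
    suff -> : row (lshift t2 j) G = row_mx (g j)%:M (V j) by [].
    rewrite /G rowKu row_row_mx rowK; congr row_mx.
    by apply/rowP => l; rewrite !mxE [l]ord1 mulr1n.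
  rewrite (_ : i = rshift t1 j); last exact/val_inj.
  suff -> : row (rshift t1 j) G = row_mx 0 (row j G2).
    by apply/genG2; exists (delta_mx 0 j); rewrite -rowE.
  by rewrite /G rowKd row_row_mx row0.
have MG w : M (w *m G) by apply: submodule_mulmx.
exists (t1 + t2)%N, G => v; split=> [Mv|[w ->]]; last exact: MG.
rewrite -[v](@hsubmxK _ 1 1 r) in Mv *.
set a := lsubmx _ in Mv *; set b := rsubmx _ in Mv *.
have ea : a = (a 0 0)%:M by apply: mx11_scalar.
have [w1 ew1] : exists w : 'I_t1 -> S, a 0 0 = \sum_j w j * g j.
  by apply: gI; exists b; rewrite -ea.
pose W1 : 'rV[S]_t1 := \row_j w1 j.
have eW1 : W1 *m (\col_j g j) = a.
  apply/matrixP => i j; rewrite [i]ord1 [j]ord1 ew1 mxE.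
  by apply: eq_bigr => l _; rewrite !mxE.
have eG : row_mx W1 0 *m G = row_mx a (W1 *m \matrix_j V j).
  by rewrite /G mul_row_col mul0mx addr0 mul_mx_row eW1.
have /genG2[w2 ew2] : N (b - W1 *m \matrix_j V j).
  rewrite /N /=; suff -> : row_mx 0 (b - W1 *m \matrix_j V j) =
      row_mx a b + (-1) *: (row_mx W1 0 *m G).
    by apply: MD => //; apply: MZ.
  by rewrite eG scaleN1r opp_row_mx add_row_mx subrr.
have -> : row_mx a b = row_mx W1 w2 *m G; last by exists (row_mx W1 w2).
by rewrite /G mul_row_col !mul_mx_row eW1 -ew2 mulmx0 add_row_mx addr0 addrC subrK.
Qed.

End Noetherian.

Section MinimalGenerators.
Variables (K : fieldType) (n : nat).
Local Notation S := {mpoly K[n]}.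

Definition graded_mx s r (ds : 'I_s -> nat) (dr : 'I_r -> nat) (N : 'M[S]_(s, r)) :=
  forall a b, N a b != 0 -> exists2 e, ds a = (dr b + e)%N & N a b \is e.-homog.

(** As [kdim 0] is 1, a row is a chain of the Koszul complex on no variables, and the lemmas on
    [hpart] apply. *)
Definition rowpart r (dr : 'I_r -> nat) d (v : 'rV[S]_r) : 'rV[S]_r :=
  hpart (k := 0) dr 0 d v.

Lemma rowpartE r (dr : 'I_r -> nat) d v i a :
  rowpart dr d v i a = gpart (dr a) d (v i a).
Proof. by rewrite mxE. Qed.

Lemma sum_gpart q (f : S) B : (msize f + q <= B)%N -> \sum_(d < B) gpart q d f = f.
Proof.
move=> le; apply/mpolyP => m; rewrite raddf_sum /=.
under eq_bigr do rewrite mcoeff_keep.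
have [mf|mf] := boolP (m \in msupp f); last first.
  by rewrite (memN_msupp_eq0 mf) big1 // => d _; case: ifP.
have lt : (mdeg m + q < B)%N by have := msize_mdeg_lt mf; lia.
rewrite (bigD1 (Ordinal lt)) //= eqxx big1 ?addr0 // => d.
by rewrite -val_eqE /= eq_sym => /negbTE ->.
Qed.

Definition graded_submodule r (dr : 'I_r -> nat) (M : set 'rV[S]_r) :=
  submodule M /\ forall d v, M v -> M (rowpart dr d v).

Lemma graded_generators r (dr : 'I_r -> nat) (M : set 'rV[S]_r) :
  graded_submodule dr M -> exists t (dt : 'I_t -> nat) (G : 'M[S]_(t, r)),
    graded_mx dt dr G /\ generates M G.
Proof.
move=> [subM grM]; have [t [G genG]] := submodule_fg subM.
(* All terms of the rows have degree below [B], so each row is the sum of its components in degrees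
   less than [B]. *)
pose B := (\max_(i : 'I_t) \max_(a : 'I_r) (msize (G i a) + dr a))%N.
pose ev (k : 'I_#|{: 'I_t * 'I_B}|) := enum_val k.
exists #|{: 'I_t * 'I_B}|, (fun k => (ev k).2 : nat),
  (\matrix_k rowpart dr (ev k).2 (row (ev k).1 G)); split.
  move=> k b; rewrite !mxE => nz; set f := G _ _ in nz *; set d := (ev k).2 : nat.
  have hom m : m \in msupp (gpart (dr b) d f) -> (mdeg m + dr b)%N = d.
    by rewrite mem_msupp_keep => /andP[/eqP].
  have /mlead_supp/hom e : gpart (dr b) d f != 0 by [].
  exists (d - dr b)%N; first by rewrite subnKC // -e leq_addl.
  by apply/dhomogP => m /hom <-; rewrite addnK.
have MG i : M (row i G) by apply/genG; exists (delta_mx 0 i); rewrite -rowE.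
move=> v; split; last first.
  move=> [w ->]; apply: submodule_mulmx => // k; rewrite rowK; exact: grM.
move=> /genG[w ->]; exists (\row_k w 0 (ev k).1).
rewrite !mulmx_sum_row.
transitivity (\sum_(p : 'I_t * 'I_B) w 0 p.1 *: rowpart dr p.2 (row p.1 G)).
  rewrite -(pair_bigA _ (fun i (d : 'I_B) => w 0 i *: rowpart dr d (row i G))) /=.
  apply: eq_bigr => i _; rewrite -scaler_sumr; congr (_ *: _).
  apply/rowP => a; rewrite summxE.
  under eq_bigr do rewrite rowpartE mxE.
  rewrite sum_gpart ?mxE // /B.
  apply: leq_trans (@leq_bigmax _ (fun i => \max_(a : 'I_r) (msize (G i a) + dr a))%N i).
  exact: (@leq_bigmax _ (fun a => msize (G i a) + dr a)%N a).
rewrite (eq_bigl (mem {: 'I_t * 'I_B})) // big_enum_val.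
by apply: eq_bigr => k _; rewrite rowK mxE.
Qed.

(** Phrased through relations because these become the rows of the next differential, for which
    [dif_minimal] asks exactly this. *)
Definition minimal_mx s r (N : 'M[S]_(s, r)) :=
  forall w : 'rV[S]_s, w *m N = 0 -> forall a, (w 0 a)@_0%MM = 0.

Lemma gpart_const q (f : S) : gpart q q f = (f@_0%MM)%:MP.
Proof.
apply/mpolyP => m; rewrite mcoeff_keep mcoeffC -mdeg_eq0 -{2}[q]add0n eqn_add2r.
by rewrite mdeg_eq0; case: eqP => [->|]; rewrite ?mulr1 ?mulr0.
Qed.

(* In a homogeneous generating family of least size, a relation with a nonzero
   constant coefficient would make one generator redundant. *)
Lemma minimal_graded_generators r (dr : 'I_r -> nat) (M : set 'rV[S]_r) :
  graded_submodule dr M -> exists t (dt : 'I_t -> nat) (G : 'M[S]_(t, r)),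
    [/\ graded_mx dt dr G, generates M G & minimal_mx G].
Proof.
move=> grM; have [t1 [dt1 [G1 G1P]]] := graded_generators grM.
pose P t := `[< exists (dt : 'I_t -> nat) (G : 'M[S]_(t, r)),
  graded_mx dt dr G /\ generates M G >].
have exP : exists t, P t by exists t1; apply/asboolP; exists dt1, G1.
have [t /asboolP[dt [G [grG genG]]] tmin] := ex_minnP exP.
exists t, dt, G; split=> // w wG a; apply: contrapT => /eqP c0.
move: dt G grG genG w wG a c0 tmin.
case: t => [|t] dt G grG genG w wG a c0 tmin; first by have := ltn_ord a.
suff /tmin : P t by rewrite ltnn.
apply/asboolP; exists (dt \o lift a), (row' a G).
split=> [b c|v]; first by rewrite mxE => /grG.
(* In this component of the relation the coefficient of row [a] is a nonzero constant, so row [a]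
   can be eliminated. *)
pose w' := rowpart dt (dt a) w.
have w'G : w' *m G = 0.
  rewrite /w' /rowpart (@hpart_mulr _ _ 0 _ _ _ _ _ _ _ _ grG) wG; apply/matrixP => i j.
  by rewrite !mxE /= raddf0.
have w'a : w' 0 a = ((w 0 a)@_0%MM)%:MP by rewrite rowpartE gpart_const.
have extend (x : 'rV[S]_t) : x *m row' a G =
    (\row_b (if unlift a b is Some c then x 0 c else 0)) *m G.
  rewrite !mulmx_sum_row (bigD1_ord a) //= mxE unlift_none scale0r add0r.
  apply: eq_bigr => b _; rewrite mxE liftK; congr (_ *: _).
  by apply/rowP => c; rewrite !mxE.
split; last by move=> [x ->]; apply/genG; rewrite extend; eexists.
move=> /genG[y ->].
have -> : y *m G = (y - ((((w 0 a)@_0%MM)^-1)%:MP * y 0 a) *: w') *m G.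
  by rewrite mulmxBl -scalemxAl w'G scaler0 subr0.
set z := y - _; have za : z 0 a = 0.
  rewrite !mxE -[gpart _ _ _]/(gpart (dt a) (dt a) (w 0 a)) gpart_const.
  by rewrite mulrAC -mpolyCM mulVf // mpolyC1 mul1r subrr.
exists (\row_b z 0 (lift a b)); rewrite !mulmx_sum_row (bigD1_ord a) //= za scale0r add0r.
apply: eq_bigr => b _; rewrite mxE; congr (_ *: _).
by apply/rowP => c; rewrite !mxE.
Qed.

Lemma kernel_graded s r (ds : 'I_s -> nat) (dr : 'I_r -> nat) (N : 'M[S]_(s, r)) :
  graded_mx ds dr N -> graded_submodule ds [set v : 'rV[S]_s | v *m N = 0].
Proof.
move=> grN; split; first split=> [|v w /= vN wN|f v /= vN].
- exact: mul0mx.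
- by rewrite mulmxDl vN wN addr0.
- by rewrite -scalemxAl vN scaler0.
move=> d v /= vN; rewrite /rowpart (@hpart_mulr _ _ 0 _ _ _ _ _ _ _ _ grN) vN.
by apply/matrixP => i j; rewrite !mxE /= raddf0.
Qed.

(** The state of the recursion that builds a resolution: a differential with what is needed to take
    its minimal syzygies. *)
Record presentation := Presentation {
  pr_r : nat; pr_s : nat; pr_dr : 'I_pr_r -> nat; pr_ds : 'I_pr_s -> nat;
  pr_mx : 'M[S]_(pr_s, pr_r);
  pr_graded : graded_mx pr_ds pr_dr pr_mx;
  pr_minimal : minimal_mx pr_mx }.

Lemma syzygies (p : presentation) :
  {t : nat & {dt : 'I_t -> nat & {G : 'M[S]_(t, pr_s p) |
    [/\ graded_mx dt (@pr_ds p) G, generates [set v | v *m pr_mx p = 0] G & minimal_mx G]}}}.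
Proof.
have /cid[t /cid[dt /cid[G GP]]] := minimal_graded_generators (kernel_graded (@pr_graded p)).
by exists t, dt, G.
Qed.

Definition next_presentation (p : presentation) : presentation :=
  let G := projT2 (projT2 (syzygies p)) in
  @Presentation (pr_s p) (projT1 (syzygies p)) (@pr_ds p) (projT1 (projT2 (syzygies p)))
    (sval G) (let: And3 h _ _ := svalP G in h) (let: And3 _ _ h := svalP G in h).

Lemma next_generates p :
  generates [set v | v *m pr_mx p = 0] (pr_mx (next_presentation p)).
Proof. by case: (svalP (projT2 (projT2 (syzygies p)))). Qed.

Fixpoint res_presentation p i : presentation :=
  if i is i'.+1 then next_presentation (res_presentation p i') else p.

Variable A : set 'X_{1..n}.
Hypothesis upA : upclosed A.

Lemma mono_row_graded : graded_submodule (fun=> 0%N) [set v : 'rV[S]_1 | mono A (v 0 0)].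
Proof.
have [L0 LD LM] := mono_is_ideal K upA; split; first split.
- by rewrite /= mxE.
- by move=> v w /= Lv Lw; rewrite mxE; apply: LD.
- by move=> f v /= Lv; rewrite mxE; apply: LM.
by move=> d v /= Lv; rewrite rowpartE; apply: gpart_mono.
Qed.

Lemma min_graded_free_res_mono : inhabited (min_graded_free_res (mono (K := K) A)).
Proof.
have [t [dt [G [grG genG minG]]]] := minimal_graded_generators mono_row_graded.
pose p := @Presentation 1 t (fun=> 0%N) dt G grG minG.
(* [st 0] is the augmentation with source [F_0], so the differential [dif i] is the matrix of
   [st i.+1]. *)
pose st := res_presentation p.
constructor; apply: (@MinGradedFreeRes _ _ _ (fun i => pr_s (st i)) (fun i => @pr_ds (st i))
  G (fun i => pr_mx (st i.+1))).
- move=> a; have [->|/grG[e]] := eqVneq (G a 0) 0; first exact: dhomog0.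
  by rewrite add0n /= => ->.
- by move=> i a b; apply: (@pr_graded (st i.+1)).
- move=> f; split=> [Lf|[v <-]].
    have /genG[w ew] : mono A ((f%:M : 'rV[S]_1) 0 0) by rewrite mxE eqxx mulr1n.
    by exists w; rewrite -ew mxE eqxx mulr1n.
  by apply/genG; exists v.
- exact: (@next_generates (st 0)).
- by move=> i; exact: (@next_generates (st i.+1)).
move=> i a b; rewrite -[LHS]/((pr_mx (st i.+1) a b)@_0%MM).
have /(@pr_minimal (st i))/(_ b) : row a (pr_mx (st i.+1)) *m pr_mx (st i) = 0.
  by apply/(@next_generates (st i)); exists (delta_mx 0 a); rewrite -rowE.
by rewrite mxE.
Qed.

End MinimalGenerators.

Section RegularityExists.
Variables (K : fieldType) (n : nat).
Local Notation S := {mpoly K[n]}.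
Variables (u : nat -> 'X_{1..n}) (k : nat).
Hypothesis u_deg : forall l, (l < k)%N -> mdeg (u l) = 1%N.
Hypothesis u_dis : forall l l', (l < l' < k)%N -> forall i, u l' i = 0%N \/ u l i = 0%N.
Hypothesis u_cov : forall m : 'X_{1..n}, m != 0%MM -> exists2 l, (l < k)%N & (u l <= m)%MM.

(** The bound of Hilbert's syzygy theorem: a basis vector in step [i] would give a nonzero class in
    Koszul degree [i], beyond the number of variables. *)
Lemma res_length (L : set S) (F : min_graded_free_res L) i : L 0 -> (k < i)%N -> rk F i = 0%N.
Proof.
move=> L0 ki; case ri: (rk F i) => [//|r].
have a : 'I_(rk F i) by rewrite ri; exact: ord0.
have [z [_ _ hz nz]] := koszul_class_of_generator u_deg u_dis u_cov a.
case: (nz 0); first by move=> j; rewrite mxE.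
rewrite mulmx0 -hz; apply/matrixP => j b; rewrite !mxE.
by case: eqP => // kj; have := kcard_le j; rewrite kj leqNgt ki.
Qed.

Lemma is_reg_mono (A : set 'X_{1..n}) : upclosed A -> (exists m, A m) ->
  exists r, is_reg (mono (K := K) A) r.
Proof.
move=> upA [m0 Am0]; have [F] := min_graded_free_res_mono K upA.
pose P r := `[< forall i (a : 'I_(rk F i)), (dg a <= r + i)%N >].
have exP : exists r, P r.
  exists (\max_(i < k.+1) \max_(a : 'I_(rk F i)) (dg a - i))%N; apply/asboolP => i a.
  have [ki|ik] := ltnP k i.
    have := ltn_ord a; rewrite [X in (_ < X)%N](res_length F _ ki) //.
    by move=> m; rewrite msupp0.
  rewrite addnC -leq_subLR; pose j : 'I_k.+1 := Ordinal (ik : (i < k.+1)%N).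
  apply: leq_trans (leq_bigmax j).
  exact: (@leq_bigmax _ (fun a : 'I_(rk F j) => dg a - j)%N a).
have [r /asboolP le rmin] := ex_minnP exP.
exists r, F; split=> //.
(* For [r = 0] minimality says nothing; there any basis vector of [F_0] attains the bound, and one
   exists because the ideal is nonzero. *)
case: r => [|r] in le rmin *.
  have [w ew] : exists w : 'rV[S]_(rk F 0), (w *m aug F) 0 0 = 'X_[m0].
    by apply/(aug_image F)/monoX.
  have [rk0|rk_gt0] := posnP (rk F 0).
    have := congr1 (fun f : S => f@_m0) ew.
    rewrite mxE big1 => [|a]; last by have := ltn_ord a; rewrite [X in (_ < X)%N]rk0.
    by rewrite mcoeffX eqxx mcoeff0 => /esym/eqP; rewrite oner_eq0.
  by exists 0%N, (Ordinal rk_gt0); apply/eqP; rewrite eqn_leq le.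
apply: contrapT => no; have /rmin : P r; last by rewrite ltnn.
apply/asboolP => i a; rewrite -ltnS -addSn ltn_neqAle le andbT.
by apply/eqP => e; apply: no; exists i, a.
Qed.

End RegularityExists.

(** * Koszul cycles of powers of sums *)

(* Any vector differs from a multiple of [v0] by an element of a subspace that is
   maximal among those containing [W] but not [v0]. *)
Lemma separating_functional (K : fieldType) (V : lmodType K) (W : set V) (v0 : V) :
    W 0 -> (forall (c : K) u v, W u -> W v -> W (c *: u + v)) -> ~ W v0 ->
  exists phi : V -> K,
    [/\ forall c u v, phi (c *: u + v) = c * phi u + phi v,
        forall w, W w -> phi w = 0 & phi v0 = 1].
Proof.
move=> W0 WL Wv0.
pose closed (X : set V) := forall (c : K) u v, X u -> X v -> X (c *: u + v).
(* The union with [W] makes [P] hold for the empty set, the union of the empty chain. *)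
pose P (X : set V) := closed (W `|` X) /\ ~ (W `|` X) v0.
have [F FP Ftot|X [[clX nX] maxX]] := @Zorn_bigcup V P.
  split=> [c u v|]; last first.
    by case=> [//|[X FX Xv0]]; case: (FP _ FX) => _; apply; right.
  have inX X : F X -> (W `|` X) u -> (W `|` X) v -> (W `|` \bigcup_(X in F) X) (c *: u + v).
    by move=> FX Xu Xv; case: (FP _ FX) => /(_ c u v Xu Xv) [|Xuv _]; [left|right; exists X].
  case=> [Wu|[X FX Xu]] [Wv|[Y FY Yv]].
  - by left; apply: WL.
  - by apply: (inX Y) => //; [left|right].
  - by apply: (inX X) => //; [right|left].
  - case: (Ftot _ _ FX FY) => XY; first by apply: (inX Y) => //; right=> //; apply: XY.
    by apply: (inX X) => //; right=> //; apply: XY.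
set M := W `|` X in clX nX.
have M0 : M 0 by left.
have Mdiv v : exists c, M (v - c *: v0).
  case: (pselect (M v)) => [Mv|nMv]; first by exists 0; rewrite scale0r subr0.
  pose Y := [set x : V | exists u c, M u /\ x = u + c *: v].
  have MY x : M x -> Y x by move=> Mx; exists x, 0; rewrite scale0r addr0.
  have clY : closed Y.
    move=> c _ _ [u1 [c1 [Mu1 ->]]] [u2 [c2 [Mu2 ->]]].
    exists (c *: u1 + u2), (c * c1 + c2); split; first exact: clX.
    by rewrite scalerDr scalerA scalerDl addrACA.
  have WY : W `|` Y = Y by apply/setUidPr => x Wx; apply: MY; left.
  have [u [c [Mu ec]]] : Y v0.
    apply: contrapT => nY; apply: (maxX Y); last by rewrite /P WY.
    split; first by move=> x Xx; apply: MY; right.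
    move=> YX; apply: nMv; right; apply: YX; exists 0, 1; split=> //.
    by rewrite scale1r add0r.
  have c0 : c != 0.
    by apply/eqP => cz; apply: nX; rewrite ec cz scale0r addr0.
  exists c^-1; have -> : v - c^-1 *: v0 = (- c^-1) *: u + 0.
    by rewrite ec scalerDr scalerA mulVf // scale1r opprD addrCA subrr !addr0 scaleNr.
  exact: clX.
have uniq_div v c c' : M (v - c *: v0) -> M (v - c' *: v0) -> c = c'.
  move=> Mc Mc'; apply/eqP; rewrite -subr_eq0; apply/negPn/negP => nz; apply: nX.
  have -> : v0 = (c - c')^-1 *: ((-1) *: (v - c *: v0) + (v - c' *: v0)) + 0.
    rewrite scaleN1r opprB addrA subrK -scalerBl scalerA mulVf // scale1r.
    by rewrite addr0.
  by apply: (clX) => //; apply: clX.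
have /choice[phi phiP] := Mdiv; exists phi; split=> [c u v|w Ww|].
- apply: uniq_div (phiP _) _.
  have -> : c *: u + v - (c * phi u + phi v) *: v0 =
      c *: (u - phi u *: v0) + (v - phi v *: v0).
    by rewrite scalerDl scalerBr scalerA opprD addrACA.
  exact: clX.
- by apply: uniq_div (phiP _) _; rewrite scale0r subr0; left.
- by apply: uniq_div (phiP _) _; rewrite scale1r subrr.
Qed.

Section Variables.
Variable n : nat.

Definition uvar (l : nat) : 'X_{1..n} := [multinom (i == l :> nat : nat) | i < n].

Lemma uvarU l : (l < n)%N -> exists i, uvar l = U_(i)%MM.
Proof.
move=> ln; exists (Ordinal ln); apply/mnmP => j.
by rewrite mnmE mnm1E -val_eqE /= eq_sym.
Qed.

Lemma uvar_deg l : (l < n)%N -> mdeg (uvar l) = 1%N.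
Proof. by move=> /uvarU[i ->]; rewrite mdeg1. Qed.

Lemma uvar_dis l l' : l != l' -> forall i, uvar l' i = 0%N \/ uvar l i = 0%N.
Proof.
move=> ll' i; rewrite !mnmE; case: eqP => [->|_]; last by left.
by right; rewrite eq_sym (negbTE ll').
Qed.

Lemma uvar_cov (m : 'X_{1..n}) : m != 0%MM -> exists2 l, (l < n)%N & (uvar l <= m)%MM.
Proof.
case md: (mdeg m) => [|d]; first by move/eqP: md; rewrite mdeg_eq0 => ->.
have [i [m' [-> _]]] := mdeg_gt0P md; exists i => //.
suff -> : uvar i = U_(i)%MM by apply: lem_addr.
by apply/mnmP => j; rewrite mnmE mnm1E -val_eqE eq_sym.
Qed.

End Variables.

Section JoinVariables.
Variables n m : nat.

(* The variables of the second ring come first, so that the recursive Koszul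
   complex of the joint ring is built on top of that of the second ring. *)
Definition ujoin (l : nat) : 'X_{1..n + m} :=
  if (l < m)%N then mjoin 0%MM (uvar m l) else mjoin (uvar n (l - m)) 0%MM.

Lemma ujoin_deg l : (l < n + m)%N -> mdeg (ujoin l) = 1%N.
Proof.
move=> ln; rewrite /ujoin; case: ltnP => lm; rewrite mdeg_join mdeg0 uvar_deg //.
by rewrite ltn_subLR // addnC.
Qed.

Lemma ujoin_dis l l' : (l < l' < n + m)%N -> forall i, ujoin l' i = 0%N \/ ujoin l i = 0%N.
Proof.
move=> /andP[ll' _] i; rewrite /ujoin.
case: (ltnP l m) => lm; case: (ltnP l' m) => l'm; rewrite -[i]splitK;
  case: (split i) => j /=; rewrite ?mjoin_lshift ?mjoin_rshift ?mnm0E;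
  first [by left | by right | apply: uvar_dis; rewrite neq_ltn; apply/orP; left; lia].
Qed.

Lemma ujoin_cov (c : 'X_{1..n + m}) : c != 0%MM -> exists2 l, (l < n + m)%N & (ujoin l <= c)%MM.
Proof.
move=> c0; have [c20|/uvar_cov[l lm le]] := eqVneq (msnd c) 0%MM; last first.
  exists l; first exact: ltn_addl.
  rewrite /ujoin lm -(mjoinK c); apply/mnm_lepP => i; rewrite -[i]splitK.
  case: (split i) => j /=; rewrite ?mjoin_lshift ?mjoin_rshift ?mnm0E //.
  exact/mnm_lepP.
have /uvar_cov[l ln le] : mfst c != 0%MM.
  by apply: contra c0 => /eqP c10; rewrite -(mjoinK c) c10 c20 mjoin0.
exists (l + m)%N; first by rewrite ltn_add2r.
rewrite /ujoin ltnNge leq_addl addnK /= -(mjoinK c); apply/mnm_lepP => i; rewrite -[i]splitK.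
case: (split i) => j /=; rewrite ?mjoin_lshift ?mjoin_rshift ?mnm0E //.
exact/mnm_lepP.
Qed.

Fixpoint pidx k : 'I_(kdim k) -> 'I_(kdim m) -> 'I_(kdim (k + m)) :=
  if k is k'.+1 return 'I_(kdim k) -> 'I_(kdim m) -> 'I_(kdim (k + m)) then
    fun i j => match split i with
      inl i' => lshift (kdim (k' + m)) (pidx i' j)
    | inr i' => rshift (kdim (k' + m)) (pidx i' j) end
  else fun _ j => j.

Lemma pidx_lshift k (i : 'I_(kdim k)) j :
  @pidx k.+1 (lshift (kdim k) i) j = lshift (kdim (k + m)) (pidx i j).
Proof. by rewrite /= (unsplitK (inl _)). Qed.

Lemma pidx_rshift k (i : 'I_(kdim k)) j :
  @pidx k.+1 (rshift (kdim k) i) j = rshift (kdim (k + m)) (pidx i j).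
Proof. by rewrite /= (unsplitK (inr _)). Qed.

Fixpoint pinv k : 'I_(kdim (k + m)) -> 'I_(kdim k) * 'I_(kdim m) :=
  if k is k'.+1 return 'I_(kdim (k + m)) -> 'I_(kdim k) * 'I_(kdim m) then
    fun l => match split (l : 'I_(kdim (k' + m) + kdim (k' + m))) with
      inl l' => (lshift (kdim k') (pinv l').1, (pinv l').2)
    | inr l' => (rshift (kdim k') (pinv l').1, (pinv l').2) end
  else fun l => (ord0, l).

Lemma pinvK k (l : 'I_(kdim (k + m))) : pidx (pinv l).1 (pinv l).2 = l.
Proof.
elim: k l => [|k IH] l //; pose l1 : 'I_(kdim (k + m) + kdim (k + m)) := l.
rewrite -[l]/l1 /=; case: (split l1) (splitK l1) => l' /= <-.
  by rewrite (unsplitK (inl _)) IH.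
by rewrite (unsplitK (inr _)) IH.
Qed.

Lemma pidxK k (i : 'I_(kdim k)) j : pinv (pidx i j) = (i, j).
Proof.
elim: k i => [|k IH] i /=; first by rewrite [i]ord1.
rewrite -[i in RHS]splitK; case: (split i) => i' /=.
  by rewrite (unsplitK (inl _)) IH.
by rewrite (unsplitK (inr _)) IH.
Qed.

Lemma kcard_pidx k (i : 'I_(kdim k)) j : kcard (pidx i j) = (kcard i + kcard j)%N.
Proof.
elim: k i => [|k IH] i //=; case: (split i) => i' /=.
  by rewrite (unsplitK (inl _)) IH.
by rewrite (unsplitK (inr _)) IH addSn.
Qed.

Variable K : fieldType.
Local Notation S := {mpoly K[n + m]}.

(* The Koszul complex of the joint variables is a tensor product: a chain becomes
   a matrix, on which the two differentials act from the left and the right. *)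
Definition unf k (c : 'cV[S]_(kdim (k + m))) : 'M[S]_(kdim k, kdim m) :=
  \matrix_(i, j) c (pidx i j) 0.

Local Notation D1 k := (kos (fun l => 'X_[mjoin (uvar n l) 0%MM] : S) k).
Local Notation D2 := (kos (fun l => 'X_[mjoin 0%MM (uvar m l)] : S) m).

Lemma unf_col k (c0 c1 : 'cV[S]_(kdim (k + m))) :
  @unf k.+1 (col_mx c0 c1) = col_mx (unf c0) (unf c1).
Proof.
apply/matrixP => i j; rewrite mxE -[i]splitK; case: (split i) => i'.
  by rewrite [unsplit _]/= pidx_lshift !col_mxEu mxE.
by rewrite [unsplit _]/= pidx_rshift !col_mxEd mxE.
Qed.

(** The differential of a tensor product; [ksgn] is the sign for moving the second differential past
    the first factor. *)
Lemma unf_kos k (c : 'cV[S]_(kdim (k + m))) :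
  unf (kos (fun l => 'X_[ujoin l]) (k + m) *m c) =
  D1 k *m unf c + ksgn S k *m unf c *m D2^T.
Proof.
elim: k c => [|k IH] c.
  rewrite mul0mx add0r mul1mx.
  have -> : kos (fun l => 'X_[ujoin l]) (0 + m) = D2.
    by apply: eq_kos => i im; rewrite /ujoin im.
  apply/matrixP => i j; rewrite !mxE; apply: eq_bigr => l _.
  by rewrite !mxE mulrC.
rewrite -(@vsubmxK _ (kdim (k + m)) (kdim (k + m)) 1 c).
set c0 := usubmx _; set c1 := dsubmx _.
rewrite [kos _ (k.+1 + m) *m _](@kosS_col _ (fun l => 'X_[ujoin l]) (k + m) 1).
rewrite !unf_col kosS_col.
have -> : ksgn S k.+1 = block_mx (ksgn S k) 0 0 (- ksgn S k) by [].
rewrite mul_block_col !mul0mx addr0 add0r mul_col_mx add_col_mx; congr col_mx.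
  have -> : unf (kos (fun l => 'X_[ujoin l]) (k + m) *m c0 + 'X_[ujoin (k + m)] *: c1) =
      unf (kos (fun l => 'X_[ujoin l]) (k + m) *m c0) + 'X_[ujoin (k + m)] *: unf c1.
    by apply/matrixP => i j; rewrite !mxE.
  by rewrite IH addrAC /ujoin ltnNge leq_addl addnK.
have -> : unf (- (kos (fun l => 'X_[ujoin l]) (k + m) *m c1)) =
    - unf (kos (fun l => 'X_[ujoin l]) (k + m) *m c1).
  by apply/matrixP => i j; rewrite !mxE.
by rewrite IH opprD !mulNmx.
Qed.

End JoinVariables.

Section ChainSupport.
Variables (K : fieldType) (n : nat).
Local Notation S := {mpoly K[n]}.

Lemma hpart0P k r p d (c : 'M[S]_(kdim k, r)) : hpart (fun=> 0%N) p d c = c <->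
  forall l b w, w \in msupp (c l b) -> kcard l = p /\ (mdeg w + p)%N = d.
Proof.
split=> [hc l b w|h].
  rewrite -hc mxE; case: eqP => [->|_]; last by rewrite msupp0.
  by rewrite mem_msupp_keep addn0 => /andP[/eqP].
apply/matrixP => l b; rewrite mxE.
have [c0|/mlead_supp/h[-> _]] := eqVneq (c l b) 0.
  by rewrite c0 raddf0; case: ifP.
by rewrite eqxx; apply: gpart_id => w /h[_ <-]; rewrite addn0.
Qed.

Lemma ksgn_entry k (i : 'I_(kdim k)) : ksgn S k i i = 1 \/ ksgn S k i i = -1.
Proof.
elim: k i => [|k IH] i; first by left; rewrite [i]ord1 mxE.
rewrite -[i]splitK; case: (split i) => j; rewrite [unsplit _]/= [ksgn _ _]/=.
  by rewrite block_mxEul; apply: IH.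
rewrite block_mxEdr mxE; case: (IH j) => ->; first by right.
by left; rewrite opprK.
Qed.

Lemma msupp_ksgn k r (c : 'M[S]_(kdim k, r)) i b :
  msupp ((ksgn S k *m c) i b) =i msupp (c i b).
Proof.
rewrite mxE (bigD1 i) //= big1 ?addr0 => [|j ji]; last first.
  by rewrite ksgn_diag ?mul0r // eq_sym.
by case: (ksgn_entry i) => -> w; rewrite ?mul1r // mulN1r (perm_mem (msuppN _)).
Qed.

(** [I ^ a.+1] being proper, [z] has no constant terms and [kcon] gives a primitive; its component
    of degree [(i.+1, d)] still bounds [z] because [z] is homogeneous. *)
Lemma kcon_primitive A a d i (z : 'cV[S]_(kdim n)) :
    upclosed A -> ~ A 0%MM -> (forall l, mono (mpow A a.+1) (z l 0)) ->
    kos (fun l => 'X_[uvar n l]) n *m z = 0 -> hpart (fun=> 0%N) i d z = z ->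
  exists z' : 'cV[S]_(kdim n), [/\ kos (fun l => 'X_[uvar n l]) n *m z' = z,
    forall l, mono (mpow A a) (z' l 0) & hpart (fun=> 0%N) i.+1 d z' = z'].
Proof.
move=> upA A0 Lz Dz hz; exists (hpart (fun=> 0%N) i.+1 d (kcon (uvar n) z)); split.
- rewrite hpart_kos; last exact: uvar_deg.
  rewrite kos_exact //.
  + by move=> l l' /andP[ll' _]; apply: uvar_dis; rewrite neq_ltn ll'.
  + exact: uvar_cov.
  move=> l j _; rewrite [j]ord1; apply: memN_msupp_eq0.
  by apply/negP => /Lz; apply: mpow0n.
- move=> l; rewrite mxE; case: ifP => _; last by move=> w; rewrite msupp0.
  apply: gpart_mono; apply: kcon_mono => [l' l'n|l1 j1]; first exact: uvarU.
  by rewrite [j1]ord1.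
- exact: hpart_id.
Qed.

End ChainSupport.

Section Product.
Variables (K : fieldType) (n m : nat).
Local Notation R := {mpoly K[n]}.
Local Notation T := {mpoly K[m]}.
Local Notation S := {mpoly K[n + m]}.
Local Notation DR := (kos (fun l => 'X_[uvar n l] : R) n).
Local Notation DT := (kos (fun l => 'X_[uvar m l] : T) m).
Local Notation DS := (kos (fun l => 'X_[ujoin n m l] : S) (n + m)).
Local Notation D1 := (kos (fun l => 'X_[mjoin (uvar n l) 0%MM] : S) n).
Local Notation D2 := (kos (fun l => 'X_[mjoin 0%MM (uvar m l)] : S) m).
Local Notation ix := (comp_mpoly [tuple 'X_(lshift m i) | i < n] : R -> S).
Local Notation iy := (comp_mpoly [tuple 'X_(rshift n j) | j < m] : T -> S).

Lemma map_DR : map_mx ix DR = D1.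
Proof. by rewrite kos_map; apply: eq_kos => l _ /=; apply: inclxX. Qed.

Lemma map_DT : map_mx iy DT = D2.
Proof. by rewrite kos_map; apply: eq_kos => l _ /=; apply: inclyX. Qed.

Lemma ksgn_ix k : map_mx ix (ksgn R k) = ksgn S k.
Proof.
elim: k => [|k IH] /=; first by rewrite map_mx1.
by rewrite map_block_mx map_mxN !map_mx0 IH.
Qed.

Lemma mem_msupp_incl f g w : w \in msupp (ix f * iy g) ->
  mfst w \in msupp f /\ msnd w \in msupp g.
Proof.
rewrite -[ix f]/(inclx m f) -[iy g]/(incly n g) inclxE inclyE mulr_suml.
move=> /msupp_sum_le /flatten_mapP[a]; rewrite filter_predT => af.
rewrite mulr_sumr => /msupp_sum_le /flatten_mapP[b]; rewrite filter_predT => bg.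
rewrite -scalerAl -scalerAr => /msuppZ_le/msuppZ_le.
by rewrite -mpolyXD -mjoin_split msuppX inE => /eqP ->; rewrite mfst_join msnd_join.
Qed.

Section Contraction.
Variable phi : {ffun 'I_(kdim n) -> R} -> K.
Hypothesis phi_lin : forall c u v, phi (c *: u + v) = c * phi u + phi v.

(** Vectors are encoded as finite functions because column matrices carry scalars in [R], while
    [phi] is linear over [K] only. *)
Definition phic i (f : R) : K := phi [ffun l => if l == i then f else 0].

Lemma phic_linear i (c : K) f g : phic i (c *: f + g) = c * phic i f + phic i g.
Proof.
rewrite -phi_lin; congr phi; apply/ffunP => l; rewrite !ffunE.
by case: ifP; rewrite ?scaler0 ?addr0.
Qed.

Lemma phi0 : phi 0 = 0.
Proof. by have := phi_lin (-1) 0 0; rewrite scaler0 addr0 mulN1r addNr. Qed.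

Lemma phi_sum (J : finType) (F : J -> {ffun 'I_(kdim n) -> R}) :
  phi (\sum_j F j) = \sum_j phi (F j).
Proof.
apply: (big_morph phi); last exact: phi0.
by move=> u v; rewrite -[u]scale1r phi_lin mul1r scale1r.
Qed.

Lemma phi_phic v : phi v = \sum_i phic i (v i).
Proof.
rewrite -phi_sum; congr phi; apply/ffunP => l; rewrite sum_ffunE (bigD1 l) //= ffunE eqxx.
by rewrite big1 ?addr0 // => i il; rewrite ffunE eq_sym (negbTE il).
Qed.

(** The tensor product of [phic i] with the identity of [T]; [contract] does the same with [phi] on
    whole chains. *)
Definition slice i : S -> T := lext (fun c => phic i 'X_[mfst c] *: 'X_[msnd c]).

HB.instance Definition _ i := GRing.Linear.on (slice i).

Lemma slice_incl i f g : slice i (ix f * iy g) = phic i f *: g.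
Proof.
apply: (@eq_linear_mpoly _ _ _ (fun f => slice i (ix f * iy g)) (fun f => phic i f *: g)).
- by move=> c f1 f2; rewrite linearP mulrDl -scalerAl linearP.
- by move=> c f1 f2; rewrite phic_linear scalerDl scalerA.
move=> a; apply: (@eq_linear_mpoly _ _ _ (fun g => slice i (ix 'X_[a] * iy g))
  (fun g => phic i 'X_[a] *: g)).
- by move=> c f1 f2; rewrite linearP mulrDr -scalerAr linearP.
- by move=> c f1 f2; rewrite scalerDr !scalerA mulrC.
by move=> b; rewrite mul_inclXX /slice lextX mfst_join msnd_join.
Qed.

Lemma slice_mull i g f : slice i (iy g * f) = g * slice i f.
Proof.
apply: (@eq_linear_mpoly _ _ _ (fun f => slice i (iy g * f)) (fun f => g * slice i f)).
- by move=> c f1 f2; rewrite mulrDr -scalerAr linearP.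
- by move=> c f1 f2; rewrite linearP mulrDr -scalerAr.
move=> c; rewrite -(mjoinK c) -mul_inclXX mulrCA -[iy g * _](rmorphM iy) !slice_incl.
by rewrite scalerAr.
Qed.

Definition contract (x : 'M[S]_(kdim n, kdim m)) : 'cV[T]_(kdim m) :=
  \col_j \sum_i slice i (x i j).

Lemma contractD x y : contract (x + y) = contract x + contract y.
Proof.
apply/colP => j; rewrite !mxE -big_split /=; apply: eq_bigr => i _.
by rewrite mxE raddfD.
Qed.

Lemma contract_outer (v : 'cV[R]_(kdim n)) (g : 'cV[T]_(kdim m)) :
  contract (map_mx ix v *m (map_mx iy g)^T) = \col_j (phi [ffun i => v i 0] *: g j 0).
Proof.
apply/colP => j; rewrite !mxE phi_phic scaler_suml; apply: eq_bigr => i _.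
by rewrite ffunE -slice_incl mxE big_ord1 !mxE.
Qed.

Lemma contract_mulr x : contract (x *m D2^T) = DT *m contract x.
Proof.
apply/colP => j; rewrite !mxE.
under eq_bigr do rewrite mxE raddf_sum /=.
rewrite exchange_big /=; apply: eq_bigr => q _.
rewrite [contract x q 0]mxE mulr_sumr; apply: eq_bigr => i _.
by rewrite mxE -map_DT mxE mulrC slice_mull.
Qed.

Lemma contract_mull x :
  (forall v : 'cV[R]_(kdim n), phi [ffun i => (DR *m v) i 0] = 0) ->
  contract (D1 *m x) = 0.
Proof.
move=> phiD; apply/colP => j; rewrite !mxE.
under eq_bigr do rewrite mxE raddf_sum /=.
rewrite exchange_big big1 //= => q _.
pose F (f : S) : T := \sum_i slice i (ix (DR i q) * f).
have -> : \sum_(i < kdim n) slice i (D1 i q * x q j) = F (x q j).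
  by apply: eq_bigr => i _; rewrite -map_DR mxE.
apply: (@eq_linear_mpoly _ _ _ F (fun=> 0)) => [c f g|c f g|c].
- rewrite /F scaler_sumr -big_split /=; apply: eq_bigr => i _.
  by rewrite mulrDr -scalerAr linearP.
- by rewrite scaler0 addr0.
have e i : slice i (ix (DR i q) * 'X_[c]) = phic i (DR i q * 'X_[mfst c]) *: 'X_[msnd c].
  by rewrite -{1}(mjoinK c) -mul_inclXX mulrA -[_ * inclx m _](rmorphM ix) slice_incl.
rewrite /F; under eq_bigr do rewrite e.
rewrite -scaler_suml.
have := phiD ('X_[mfst c] *: delta_mx q 0); rewrite phi_phic => h.
rewrite (_ : \sum_i _ = 0) ?scale0r //; rewrite -[RHS]h; apply: eq_bigr => i _.
congr phic; rewrite ffunE -scalemxAr -colE !mxE mulrC //.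
Qed.

(** A monomial of the power lies in some [I^p J^q] with [p + q = a + b + 1]. Either [p > a] and
    [phi] kills its first component, or [q > b] and its second component is in [J ^ b.+1]. *)
Lemma slice_mono (A : set 'X_{1..n}) (B : set 'X_{1..m}) a b i f :
    upclosed A -> upclosed B ->
    (forall w, mpow A a.+1 w -> phic i 'X_[w] = 0) ->
    mono (mpow (mor A B) (a + b).+1) f -> mono (mpow B b.+1) (slice i f).
Proof.
move=> upA upB phiA Lf; have idB := mono_is_ideal K (@upclosed_mpow m B b.+1).
rewrite /slice /lext; apply: (ideal_sum idB) => c /Lf /(mpow_mor _ _ upA upB)[p [q [pq Ap Bq]]] _.
have [ap|pa] := ltnP a p.
  rewrite phiA ?scale0r ?scaler0; first by case: idB.
  exact: mpow_le ap Ap.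
rewrite scalerA -mul_mpolyC; case: idB => _ _; apply; apply/monoX.
by apply: mpow_le Bq; lia.
Qed.

End Contraction.

(* With [z = d z'] and [w = d w'], the cycle is [z * w' + s * w], where [s] is [z'] up
   to signs.  If it were the boundary of a chain over [(I + J) ^ k], contracting
   the first factor with a functional that kills boundaries and the chains over
   [I ^ a.+1], but not [s], would make [w] a boundary over [J ^ b.+1]. *)
Lemma koszul_product (A : set 'X_{1..n}) (B : set 'X_{1..m}) a b i j d1 d2
    (z : 'cV[R]_(kdim n)) (w : 'cV[T]_(kdim m)) :
    upclosed A -> upclosed B -> ~ A 0%MM -> ~ B 0%MM ->
    (forall l, mono (mpow A a.+1) (z l 0)) -> DR *m z = 0 -> hpart (fun=> 0%N) i d1 z = z ->
    (forall y : 'cV[R]_(kdim n), (forall l, mono (mpow A a.+1) (y l 0)) -> z <> DR *m y) ->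
    (forall l, mono (mpow B b.+1) (w l 0)) -> DT *m w = 0 -> hpart (fun=> 0%N) j d2 w = w ->
    (forall y : 'cV[T]_(kdim m), (forall l, mono (mpow B b.+1) (y l 0)) -> w <> DT *m y) ->
  exists c : 'cV[S]_(kdim (n + m)),
    [/\ forall l, mono (mpow (mor A B) (a + b).+1) (c l 0), DS *m c = 0,
      hpart (fun=> 0%N) (i + j).+1 (d1 + d2) c = c &
      forall y : 'cV[S]_(kdim (n + m)), (forall l, mono (mpow (mor A B) (a + b).+1) (y l 0)) ->
        c <> DS *m y].
Proof.
move=> upA upB A0 B0 Az Dz hz nz Bw Dw hw nw.
have [z' [Dz' Az' hz']] := kcon_primitive upA A0 Az Dz hz.
have [w' [Dw' Bw' hw']] := kcon_primitive upB B0 Bw Dw hw.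
set L := mpow (mor A B) (a + b).+1.
pose s := ksgn R n *m z'.
pose C : 'M[S]_(kdim n, kdim m) :=
  map_mx ix z *m (map_mx iy w')^T + map_mx ix s *m (map_mx iy w)^T.
pose c : 'cV[S]_(kdim (n + m)) := \col_l C (pinv l).1 (pinv l).2.
have cC : unf c = C by apply/matrixP => p q; rewrite !mxE pidxK.
have CE p q : C p q = ix (z p 0) * iy (w' q 0) + ix (s p 0) * iy (w q 0).
  by rewrite !mxE !big_ord1 !mxE.
have suppC p q v : v \in msupp (C p q) ->
    (mfst v \in msupp (z p 0) /\ msnd v \in msupp (w' q 0)) \/
    (mfst v \in msupp (z' p 0) /\ msnd v \in msupp (w q 0)).
  rewrite CE => /msuppD_le; rewrite mem_cat => /orP[/mem_msupp_incl|/mem_msupp_incl].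
    by left.
  by rewrite msupp_ksgn; right.
exists c; split.
- move=> l v; rewrite mxE => /suppC[[/Az h1 /Bw' h2]|[/Az' h1 /Bw h2]].
    by apply/(mpow_mor _ _ upA upB); exists a.+1, b; rewrite addSn.
  by apply/(mpow_mor _ _ upA upB); exists a, b.+1; rewrite addnS.
- suff uc0 : unf (DS *m c) = 0.
    apply/colP => l; rewrite -[in LHS](pinvK l).
    by have /matrixP/(_ (pinv l).1 (pinv l).2) := uc0; rewrite !mxE.
  (* What survives is [D s *m w^T] and [ksgn z *m w^T], up to inclusions; they cancel because [ksgn]
     anticommutes with the differential and [z'] bounds [z]. *)
  rewrite unf_kos cC /C mulmxDr mulmxDr mulmxDl !mulmxA -map_DR -map_DT -!map_mxM Dz.
  rewrite -ksgn_ix -!map_mxM -!mulmxA -!trmx_mul -!map_mxM Dw' Dw.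
  rewrite !map_mx0 trmx0 !mul0mx mulmx0 add0r addr0 /s mulmxA.
  by rewrite -[DR *m _]opprK -ksgn_kos mulNmx -mulmxA Dz' map_mxN mulNmx addNr.
- apply/hpart0P => l q v; rewrite mxE -{3}(pinvK l) kcard_pidx => vC.
  have -> : mdeg v = (mdeg (mfst v) + mdeg (msnd v))%N by rewrite -mdeg_join mjoinK.
  move/hpart0P: hz => hz; move/hpart0P: hz' => hz'.
  move/hpart0P: hw => hw; move/hpart0P: hw' => hw'.
  case: (suppC _ _ _ vC) => [[/hz[-> <-] /hw'[-> <-]]|[/hz'[-> <-] /hw[-> <-]]]; lia.
move=> y Ly cy.
pose col (v : {ffun 'I_(kdim n) -> R}) : 'cV[R]_(kdim n) := \col_l v l.
pose W : set {ffun 'I_(kdim n) -> R} := [set v | exists (x1 x2 : 'cV[R]_(kdim n)),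
  (forall l, mono (mpow A a.+1) (x1 l 0)) /\ col v = x1 + DR *m x2].
have idA := mono_is_ideal K (@upclosed_mpow n A a.+1).
have [A_0 AD AM] := idA.
have W0 : W 0.
  exists 0, 0; split=> [l|]; first by rewrite mxE.
  by rewrite mulmx0 addr0; apply/colP => l; rewrite !mxE ffunE.
have WL (k : K) v1 v2 : W v1 -> W v2 -> W (k *: v1 + v2).
  move=> [x1 [x2 [Ax e1]]] [y1 [y2 [Ay e2]]]; exists (k%:MP *: x1 + y1), (k%:MP *: x2 + y2).
  split=> [l|]; first by rewrite mxE; apply: AD => //; rewrite mxE; apply: AM.
  have -> : col (k *: v1 + v2) = k%:MP *: col v1 + col v2.
    by apply/colP => l; rewrite !mxE !ffunE mul_mpolyC.
  by rewrite e1 e2 mulmxDr -scalemxAr scalerDr addrACA.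
pose v0 := [ffun l => s l 0].
have Wv0 : ~ W v0.
  move=> [x1 [x2 [Ax e]]].
  have es : s = x1 + DR *m x2 by rewrite -e; apply/colP => l; rewrite [RHS]mxE ffunE.
  (* With the sign undone, [ksgn x1] differs from [z'] by a boundary, so it too has boundary [z],
     but over [I ^ a.+1]. *)
  apply: (nz (ksgn R n *m x1)) => [l v|].
    by rewrite msupp_ksgn; apply: Ax.
  have -> : ksgn R n *m x1 = z' - ksgn R n *m (DR *m x2).
    by rewrite -[z']mul1mx -(ksgn_sq R) -mulmxA -/s es mulmxDr addrK.
  by rewrite mulmxBr Dz' (mulmxA (ksgn _ _)) ksgn_kos mulNmx mulmxN opprK
     -mulmxA [DR *m (DR *m _)]mulmxA kos_sq mul0mx addr0.
have [phi [phi_lin phiW phi1]] := separating_functional W0 WL Wv0.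
have colK (x : 'cV[R]_(kdim n)) : col [ffun l => x l 0] = x.
  by apply/colP => l; rewrite [LHS]mxE ffunE.
have phiD (x : 'cV[R]_(kdim n)) : phi [ffun l => (DR *m x) l 0] = 0.
  apply: phiW; exists 0, x; split=> [l|]; first by rewrite mxE.
  by rewrite add0r colK.
have phiA (x : 'cV[R]_(kdim n)) : (forall l, mono (mpow A a.+1) (x l 0)) ->
    phi [ffun l => x l 0] = 0.
  by move=> Ax; apply: phiW; exists x, 0; rewrite mulmx0 addr0 colK.
have phicA l v : mpow A a.+1 v -> phic phi l 'X_[v] = 0.
  move=> Av; rewrite /phic -(phiA (\col_p if p == l then 'X_[v] else 0)).
    by congr phi; apply/ffunP => p; rewrite !ffunE mxE.
  by move=> p; rewrite mxE; case: ifP => _; [exact/monoX|].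
have idL := mono_is_ideal K (@upclosed_mpow (n + m) (mor A B) (a + b).+1).
pose x := contract phi (ksgn S n *m unf y).
apply: (nw x) => [l|].
  have idB := mono_is_ideal K (@upclosed_mpow m B b.+1).
  rewrite mxE; apply: (ideal_sum idB) => p _ _.
  apply: (slice_mono upA upB) => [v|v]; first exact: phicA.
  by rewrite msupp_ksgn mxE; apply: Ly.
(* On the left, the term with [z] vanishes and the one with [s] contributes [w]; on the right only
   the differential of the second factor remains. *)
have := congr1 (contract phi) (congr1 (@unf n m K n) cy).
rewrite cC /C unf_kos !contractD // contract_mull // contract_mulr // add0r -/x.
rewrite !contract_outer // phiA // phi1 => <-.
by apply/colP => l; rewrite !mxE scale0r add0r scale1r.
Qed.

End Product.

(** * Regularity and v-number of powers of sums *)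

Section PowersOfSums.
Variables (K : fieldType) (n m : nat) (A : set 'X_{1..n}) (B : set 'X_{1..m}).
Hypotheses (upA : upclosed A) (upB : upclosed B) (A0 : ~ A 0%MM) (B0 : ~ B 0%MM).

Lemma uvar_dis_lt p l l' : (l < l' < p)%N ->
  forall i, uvar p l' i = 0%N \/ uvar p l i = 0%N.
Proof. by move=> /andP[ll' _]; apply: uvar_dis; rewrite neq_ltn ll'. Qed.

(* [koszul_product] adds the degrees and the homological degrees of the two
   classes, the latter with an additional shift by one. *)
Lemma is_reg_power_sum a b r1 r2 r :
  is_reg (mono (K := K) (mpow A a.+1)) r1 -> is_reg (mono (K := K) (mpow B b.+1)) r2 ->
  is_reg (mono (K := K) (mpow (mor A B) (a + b).+1)) r -> (r1 + r2 <= r.+1)%N.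
Proof.
move=> [F [_ [i [e de]]]] [G [_ [j [f df]]]] [H [le _]].
have [z [Az Dz hz nz]] :=
  koszul_class_of_generator (@uvar_deg n) (@uvar_dis_lt n) (@uvar_cov n) e.
have [w [Bw Dw hw nw]] :=
  koszul_class_of_generator (@uvar_deg m) (@uvar_dis_lt m) (@uvar_cov m) f.
have [c [Lc Dc hc nc]] := koszul_product upA upB A0 B0 Az Dz hz nz Bw Dw hw nw.
have [g dg_g] := generator_of_koszul_class (@ujoin_deg n m) (@ujoin_dis n m)
  (@ujoin_cov n m) H Lc Dc hc nc.
by have := le _ g; rewrite dg_g de df; lia.
Qed.

Lemma mpow_muln C k (c : 'X_{1..n}) : C c -> mpow C k (c *+ k)%MM.
Proof. by move=> Cc; elim: k => //= k IH; exists c, (c *+ k)%MM; rewrite mulmS. Qed.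

(* An associated prime of [I ^ k] contains [I]; hence, for large [k], a monomial
   [u] realizing it lies in [I ^ k : I = I ^ (k - 1)]. *)
Lemma var_colon_power k0 a u P :
    (forall k u, (k0 <= k)%N -> (forall c, A c -> mpow A k.+1 (u + c)%MM) -> mpow A k u) ->
  (k0 <= a)%N -> var_colon (mpow A a.+1) u P -> mpow A a u.
Proof.
move=> rat ka uP; apply: rat => // c Ac; apply/uP.
have /uP[i Pi ci] : mpow A a.+1 (u + c *+ a.+1)%MM.
  by rewrite addmC; apply: upclosed_mpow; apply: mpow_muln.
by exists i => //; move: ci; rewrite mulmnE muln_eq0 negb_or => /andP[].
Qed.

Lemma var_colon_join a b u v P Q :
    mpow A a u -> mpow B b v ->
    var_colon (mpow A a.+1) u P -> var_colon (mpow B b.+1) v Q ->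
  var_colon (mpow (mor A B) (a + b).+1) (mjoin u v)
    [set i | match split i with inl j => P j | inr j => Q j end].
Proof.
move=> Au Bv uP vQ c; rewrite -(mjoinK c) -mjoinD; split.
  move=> /(mpow_mor _ _ upA upB)[p [q [pq]]]; rewrite mfst_join msnd_join => Ap Bq.
  have [ap|pa] := ltnP a p.
    have /uP[i Pi ci] := mpow_le ap Ap.
    by exists (lshift m i); rewrite /= ?(unsplitK (inl _)) // mjoin_lshift.
  have bq : (b.+1 <= q)%N by lia.
  have /vQ[i Qi ci] := mpow_le bq Bq.
  by exists (rshift n i); rewrite /= ?(unsplitK (inr _)) // mjoin_rshift.
move=> [i Pi ci]; apply/(mpow_mor _ _ upA upB); rewrite mfst_join msnd_join.
move: Pi ci => /=; rewrite -[in mjoin _ _ i](splitK i); case: (split i) => j Pj /=.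
  rewrite mjoin_lshift => cj; exists a.+1, b; split; first by rewrite addSn.
    by apply/uP; exists j.
  exact: upclosed_mpow.
rewrite mjoin_rshift => cj; exists a, b.+1; split; first by rewrite addnS.
  exact: upclosed_mpow.
by apply/vQ; exists j.
Qed.

End PowersOfSums.

(** A positive value is not the default 0. For the powers of [I] and [J] positivity comes from
    [v < reg]; for those of the sum, a resolution has to be constructed. *)
Lemma is_reg_reg (K : fieldType) n (L : set {mpoly K[n]}) : (0 < reg L)%N -> is_reg L (reg L).
Proof. by rewrite /reg; case: xgetP. Qed.

Lemma is_reg_reg_mono (K : fieldType) n m (A : set 'X_{1..n + m}) :
  upclosed A -> (exists c, A c) -> is_reg (mono (K := K) A) (reg (mono (K := K) A)).
Proof.
move=> upA exA; rewrite /reg; case: xgetP => // no.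
by have [r /no] := is_reg_mono K (@ujoin_deg n m) (@ujoin_dis n m) (@ujoin_cov n m) upA exA.
Qed.

Lemma mono_proper (K : fieldType) n (A : set 'X_{1..n}) :
  upclosed A -> mono (K := K) A <> setT -> ~ A 0%MM.
Proof.
move=> upA nT A0; apply: nT; rewrite eqEsubset; split=> // f _ m _.
by rewrite -[m]add0m; apply: upA.
Qed.

Lemma mono_nonzero (K : fieldType) n (A : set 'X_{1..n}) :
  mono (K := K) A <> [set 0] -> exists m, A m.
Proof.
move=> nz; apply: contrapT => noA; apply: nz; rewrite eqEsubset; split=> f.
  move=> Af; apply/eqP/negPn/negP => /mlead_supp/Af Am; by apply: noA; eexists; exact: Am.
by move=> -> m; rewrite msupp0.
Qed.

Theorem corollary4p4 (K : fieldType) (n m : nat)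
    (I : set {mpoly K[n]}) (J : set {mpoly K[m]})
    (monI : monomial_ideal I) (properI : I <> setT) (nzI : I <> [set 0])
    (monJ : monomial_ideal J) (properJ : J <> setT) (nzJ : J <> [set 0])
    (ltI : exists k0 : nat, forall k : nat, (k0 <= k)%N ->
       (vnum (idealX I k) < reg (idealX I k))%N)
    (ltJ : exists k0 : nat, forall k : nat, (k0 <= k)%N ->
       (vnum (idealX J k) < reg (idealX J k))%N) :
  exists k0 : nat, forall k : nat, (k0 <= k)%N ->
    (vnum (idealX (idealD (extx m I) (exty n J)) k)
       < reg (idealX (idealD (extx m I) (exty n J)) k))%N.
Proof.
have [A upA eI] := monomial_idealP monI; have [B upB eJ] := monomial_idealP monJ; subst I J.
have A0 := mono_proper upA properI; have B0 := mono_proper upB properJ.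
have exA := mono_nonzero nzI; have exB := mono_nonzero nzJ.
have [kA ratA] := ratliff upA exA; have [kB ratB] := ratliff upB exB.
have [kI {}ltI] := ltI; have [kJ {}ltJ] := ltJ.
(* [k1] is at least all four thresholds. The exponents are [k1 + 1], fixed, and [b + 1], with sum
   [k + 1]; the bound [k >= 2 k1 + 1] gives [b >= k1]. *)
pose k1 := (kA + kB + kI + kJ)%N.
exists (k1 + k1).+1 => k lek.
pose b := (k - k1.+1)%N.
have ek : k = (k1 + b).+1 by rewrite /b; lia.
have {}ltI : (vnum (mono (K := K) (mpow A k1.+1)) < reg (mono (K := K) (mpow A k1.+1)))%N.
  by rewrite -idealX_mono //; apply: ltI; rewrite /k1; lia.
have {}ltJ : (vnum (mono (K := K) (mpow B b.+1)) < reg (mono (K := K) (mpow B b.+1)))%N.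
  by rewrite -idealX_mono //; apply: ltJ; rewrite /b /k1; lia.
rewrite idealD_mono // (idealX_mono _ _ (upclosed_mor upA upB)) ek.
have upL := @upclosed_mpow (n + m) (mor A B) (k1 + b).+1.
have [u [P [du uP]]] := vnum_mono_attained K (@upclosed_mpow n A k1.+1) (mpow0n A0 (ltn0Sn k1)).
have [v [Q [dv vQ]]] := vnum_mono_attained K (@upclosed_mpow m B b.+1) (mpow0n B0 (ltn0Sn b)).
have Au : mpow A k1 u by apply: var_colon_power ratA _ uP; rewrite /k1; lia.
have Bv : mpow B b v by apply: var_colon_power ratB _ vQ; rewrite /b /k1; lia.
have := vnum_mono_le K (var_colon_join upA upB Au Bv uP vQ).
have exL : exists c, mpow (mor A B) (k1 + b).+1 c.
  have [a Aa] := exA; exists (mjoin a 0 *+ (k1 + b).+1)%MM.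
  by apply: mpow_muln; left; rewrite mfst_join.
have regI := is_reg_reg (leq_ltn_trans (leq0n _) ltI).
have regJ := is_reg_reg (leq_ltn_trans (leq0n _) ltJ).
have := is_reg_power_sum upA upB A0 B0 regI regJ (is_reg_reg_mono K upL exL).
by rewrite mdeg_join du dv; move: ltI ltJ; lia.
Qed.
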